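(* (Memory lower bound for direct sums of $k$ dictators.) There exist absolute constants $\varepsilon_0,\beta_0,c,C>0$ such that for all integers $k\ge1$, $d'\ge C$, $N\ge1$: every streaming algorithm that, from a stream of $N$ i.i.d. examples, agnostically learns the class $\mathcal H_{DS}$ of direct sums of $k$ dictators over $\mathcal X=[k]\times\{0,1\}^{d'}$ to error $\varepsilon_0$ with probability at least $1-\beta_0$ uses at least $c\cdot k d'\cdot\frac{k}{N}$ bits of memory. In particular, with $d=d'+\log_2 k$, in the regime $d=\omega(\log k)$ the memory is $\Omega\left(kd\cdot\frac{k}{N}\right)$ bits.
   Context: **The class.** For indices $i_1,\dots,i_k\in[d']$, the function $h_{i_1,\dots,i_k}:[k]\times\{0,1\}^{d'}\to\{0,1\}$ is $h_{i_1,\dots,i_k}(j,x)=x_{i_j}$. $\mathcal H_{DS}$ is the set of all such functions. **Agnostic learning.** For a distribution $P$ on $\mathcal X\times\{0,1\}$ and $h:\mathcal X\to\{0,1\}$, $\mathrm{err}_P(h)=\Pr_{(x,y)\sim P}[h(x)\ne y]$. An algorithm agnostically learns $\mathcal H$ to error $\varepsilon_0$ with probability at least $1-\beta_0$ if for every distribution $P$ on $\mathcal X\times\{0,1\}$, on $N$ i.i.d. samples from $P$ it outputs, with probability at least $1-\beta_0$, a hypothesis $h$ (not necessarily in $\mathcal H$) with $\mathrm{err}_P(h)\le\inf_{h'\in\mathcal H}\mathrm{err}_P(h')+\varepsilon_0$. **Streaming algorithm and memory.** A one-pass streaming algorithm processes the examples one by one; its state after each example is a (possibly randomized) function of the previous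 state and the current example, and its output is a function of the final state. Its memory is the maximum number of bits used to encode its state between examples. *)

(* Defs.v *)
From HB Require Import structures.
From mathcomp Require Import all_boot all_order all_algebra.
From mathcomp Require Import all_classical all_reals all_analysis.

Set Implicit Arguments.
Unset Strict Implicit.
Unset Printing Implicit Defensive.

Import Order.TTheory GRing.Theory Num.Theory.
Import numFieldNormedType.Exports.

Local Open Scope classical_set_scope.
Local Open Scope ring_scope.

Section FiniteDistributions.
Variable R : realType.

Record dist (T : finType) := Dist {
  pmf :> T -> R;
  pmf_ge0 : forall x, 0 <= pmf x;
  pmf_sum1 : \sum_x pmf x = 1
}.

Definition Pr (T : finType) (p : dist T) (E : pred T) : R := \sum_(x | E x) p x.

Fact dret_ge0 (T : finType) (a x : T) : 0 <= (x == a)%:R :> R.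
Proof. by []. Qed.

Fact dret_sum1 (T : finType) (a : T) : \sum_x (x == a)%:R = 1 :> R.
Proof.
rewrite (bigD1 a) //= eqxx big1 ?addr0 // => x /negbTE ->; by [].
Qed.

Definition dret (T : finType) (a : T) : dist T :=
  Dist (dret_ge0 a) (dret_sum1 a).

Fact dbind_ge0 (T U : finType) (p : dist T) (f : T -> dist U) y :
  0 <= \sum_x p x * f x y.
Proof. by apply: sumr_ge0 => x _; rewrite mulr_ge0 ?pmf_ge0. Qed.

Fact dbind_sum1 (T U : finType) (p : dist T) (f : T -> dist U) :
  \sum_y \sum_x p x * f x y = 1.
Proof.
rewrite exchange_big /= -[RHS](pmf_sum1 p); apply: eq_bigr => x _.
by rewrite -mulr_sumr pmf_sum1 mulr1.
Qed.

Definition dbind (T U : finType) (p : dist T) (f : T -> dist U) : dist U :=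
  Dist (dbind_ge0 p f) (dbind_sum1 p f).

Fact iid_ge0 (T : finType) (p : dist T) N (z : {ffun 'I_N -> T}) :
  0 <= \prod_i p (z i).
Proof. by apply: prodr_ge0 => i _; exact: pmf_ge0. Qed.

Fact iid_sum1 (T : finType) (p : dist T) N :
  \sum_(z : {ffun 'I_N -> T}) \prod_i p (z i) = 1.
Proof.
by rewrite -(bigA_distr_bigA (fun _ => p)) big1 // => i _; exact: pmf_sum1.
Qed.

Definition iid (T : finType) (p : dist T) N : dist {ffun 'I_N -> T} :=
  Dist (@iid_ge0 T p N) (iid_sum1 p N).

End FiniteDistributions.

Section Learning.
Variables (R : realType) (X : finType).

Definition err (P : dist R (X * bool)%type) (h : X -> bool) : R :=
  Pr P (fun z => h z.1 != z.2).

(* [state t] is the set of possible states after [t] examples and [enc t] its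
   binary encoding; states, transitions and encodings may depend on [t], and
   the randomness of each transition is fresh, hence reusable later only if it
   is kept in the state. *)
Record streaming_alg (N : nat) := StreamingAlg {
  state : nat -> finType;
  enc : forall t, state t -> seq bool;
  enc_inj : forall t, injective (@enc t);
  init : state 0;
  step : forall t, state t -> X * bool -> dist R (state t.+1);
  output : state N -> X -> bool
}.

(* Distribution of the state after the [t] examples [z 0, ..., z t.-1]. *)
Fixpoint run N (A : streaming_alg N) (t : nat) :
    ('I_t -> X * bool) -> dist R (state A t) :=
  match t with
  | 0 => fun _ => dret R (init A)
  | t'.+1 => fun z =>
      dbind (run A (fun i : 'I_t' => z (widen_ord (leqnSn t') i)))
            (fun s => step s (z ord_max))
  end.

Definition final_state N (A : streaming_alg N) (P : dist R (X * bool)%type) :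
  dist R (state A N) := dbind (iid P N) (fun z => run A z).

(* Only the states held between two consecutive examples are counted: neither
   the initial state nor the one read off by [output] contributes. *)
Definition memory N (A : streaming_alg N) : nat :=
  \max_(1 <= t < N) \max_(s : state A t) size (enc s).

Definition agnostically_learns N (A : streaming_alg N)
    (H : set (X -> bool)) (eps0 beta0 : R) : Prop :=
  forall P : dist R (X * bool)%type,
    1 - beta0 <= Pr (final_state A P)
      (fun s => err P (output s) <= inf [set err P h | h in H] + eps0).

End Learning.

Section DirectSums.

Definition ds_input (k d' : nat) : finType :=
  ('I_k * {ffun 'I_d' -> bool})%type.

Definition ds_dictator k d' (i : 'I_k -> 'I_d') (z : ds_input k d') : bool :=
  z.2 (i z.1).

Definition HDS k d' : set (ds_input k d' -> bool) := range (@ds_dictator k d').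

End DirectSums.

Definition log2 (R : realType) (x : R) : R := ln x / ln 2.

(* Main.v *)
(** Hard instances: the group [j] is uniform on [k] and [x] is uniform on the cube; in a
    planted group the label agrees with [x_i] with probability 3/4 for a hidden
    index [i], in a null group it is a fair coin.  Each group is planted with
    probability 1/2.  A learner must recover most of the planted indices, whereas
    a hypothesis computed with group [j] null is close to a random [x_i] with
    probability O(1/d).  So planting a null group [j] must change the law of the
    state noticeably, i.e. the relative entropy between the two laws is
    bounded below on average over [i] and [j].

    Fix the sequence of groups of the stream.  Then the state is a Markov chain, and
    by the chain rule the relative entropy is at most the sum, over the
    occurrences of [j], of that of the state held just before the next occurrence
    of [j].  Averaged over [i], a level-1 inequality bounds each term by
    4/d times the information this state carries on the example, given the state
    before the example.  At a fixed time these informations, summed over all past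
    examples, are at most the entropy of the state, hence O(memory); and since the next
    group is uniform and independent of the past, only one k-th of this is charged
    at each step.  Summing over [j] and time gives [memory * N / k >= c * k * d]. *)

Require Import Defs.
From HB Require Import structures.
From mathcomp Require Import all_boot all_order all_algebra.
From mathcomp Require Import all_classical all_reals all_analysis.
From mathcomp Require Import ring lra.

Import Order.TTheory GRing.Theory Num.Theory.
Import numFieldNormedType.Exports.

Local Open Scope classical_set_scope.
Local Open Scope ring_scope.

(** * Expectations over finite distributions *)

Section Expectation.
Set Implicit Arguments.
Unset Strict Implicit.
Context {R : realType}.

Definition ex {T : finType} (p : dist R T) (f : T -> R) : R := \sum_x p x * f x.

Lemma ex_dret (T : finType) (a : T) f : ex (dret R a) f = f a.
Proof.
rewrite /ex (bigD1 a) //= eqxx mul1r big1 ?addr0 // => x /negbTE ->.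
by rewrite mul0r.
Qed.

Lemma dbindE (T U : finType) (p : dist R T) (f : T -> dist R U) y :
  dbind p f y = ex p (fun x => f x y).
Proof. by []. Qed.

Lemma ex_dbind (T U : finType) (p : dist R T) (f : T -> dist R U) F :
  ex (dbind p f) F = ex p (fun x => ex (f x) F).
Proof.
rewrite /ex; under eq_bigr do rewrite /= mulr_suml.
rewrite exchange_big; apply: eq_bigr => x _ /=; rewrite mulr_sumr.
by apply: eq_bigr => y _; rewrite mulrA.
Qed.

Lemma eq_ex (T : finType) (p : dist R T) f g : f =1 g -> ex p f = ex p g.
Proof. by move=> fg; apply: eq_bigr => x _; rewrite fg. Qed.

Lemma eq_exl (T : finType) (p q : dist R T) f : p =1 q -> ex p f = ex q f.
Proof. by move=> pq; apply: eq_bigr => x _; rewrite pq. Qed.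

Lemma le_ex (T : finType) (p : dist R T) f g :
  (forall x, f x <= g x) -> ex p f <= ex p g.
Proof. by move=> fg; rewrite /ex; apply: ler_sum => x _; rewrite ler_wpM2l ?Defs.pmf_ge0. Qed.

Lemma ex_ge0 (T : finType) (p : dist R T) f : (forall x, 0 <= f x) -> 0 <= ex p f.
Proof. by move=> f0; rewrite /ex; apply: sumr_ge0 => x _; rewrite mulr_ge0 ?Defs.pmf_ge0. Qed.

Lemma ex_cst (T : finType) (p : dist R T) c : ex p (fun=> c) = c.
Proof. by rewrite /ex -mulr_suml pmf_sum1 mul1r. Qed.

Lemma ex0 (T : finType) (p : dist R T) : ex p (fun=> 0) = 0.
Proof. exact: ex_cst. Qed.

Lemma exD (T : finType) (p : dist R T) f g :
  ex p (fun x => f x + g x) = ex p f + ex p g.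
Proof. by rewrite /ex -big_split; apply: eq_bigr => x _; rewrite mulrDr. Qed.

Lemma exZ (T : finType) (p : dist R T) c f :
  ex p (fun x => c * f x) = c * ex p f.
Proof. by rewrite /ex mulr_sumr; apply: eq_bigr => x _; rewrite mulrCA. Qed.

Lemma exB (T : finType) (p : dist R T) f g :
  ex p (fun x => f x - g x) = ex p f - ex p g.
Proof. by rewrite /ex -sumrB; apply: eq_bigr => x _; rewrite mulrBr. Qed.

Lemma ex_sum (T I : finType) (P : pred I) (p : dist R T) (f : I -> T -> R) :
  ex p (fun x => \sum_(i | P i) f i x) = \sum_(i | P i) ex p (f i).
Proof. by rewrite /ex [RHS]exchange_big; apply: eq_bigr => x _; rewrite mulr_sumr. Qed.

Lemma ex_ind_le1 (T : finType) (p : dist R T) (P : pred T) :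
  ex p (fun x => (P x)%:R) <= 1.
Proof. by rewrite -[leRHS](ex_cst p); apply: le_ex => x; case: (P x). Qed.

Lemma PrE (T : finType) (p : dist R T) (P : pred T) :
  Pr p P = ex p (fun x => (P x)%:R).
Proof.
rewrite /Pr /ex big_mkcond; apply: eq_bigr => x _.
by case: (P x); rewrite ?mulr1 ?mulr0.
Qed.

Lemma dbind_dret (T U : finType) (a : T) (f : T -> dist R U) :
  dbind (dret R a) f =1 f a.
Proof. by move=> y; rewrite dbindE ex_dret. Qed.

Lemma dbindA (T U V : finType) (p : dist R T) (f : T -> dist R U)
    (g : U -> dist R V) :
  dbind (dbind p f) g =1 dbind p (fun x => dbind (f x) g).
Proof. by move=> z; rewrite dbindE ex_dbind. Qed.

End Expectation.

(** * Entropy and relative entropy *)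

Section Entropy.
Set Implicit Arguments.
Unset Strict Implicit.
Context {R : realType}.

Definition kl {T : finType} (q p : T -> R) : R := \sum_x q x * ln (q x / p x).

(** Absolute continuity. With [x / 0 = 0] and [ln 0 = 0], [kl] drops the points where only [p]
    vanishes, so it is the relative entropy only under this condition. *)
Definition ac {T : finType} (q p : T -> R) := forall x, p x = 0 -> q x = 0.

Definition entropy {T : finType} (p : T -> R) : R := - \sum_x p x * ln (p x).

Lemma ln_le_sub1 (x : R) : 0 < x -> ln x <= x - 1.
Proof. by move=> x0; have := @le_ln1Dx R (x - 1); rewrite addrCA subrr addr0; apply; lra. Qed.

(** This is [ln t <= t - 1] at [t = c * p / q], a tangent bound with equality at [q / p = c]. The
    contact point [c] is left free: [log_sum] takes the overall ratio, [kl_test] takes 1 and e. *)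
Lemma log_sum_term (q p c : R) : 0 <= q -> 0 <= p -> (p = 0 -> q = 0) -> 0 < c ->
  q * ln c + q - p * c <= q * ln (q / p).
Proof.
move=> q0 p0 qp c0; have [q0'|qn0] := eqVneq q 0.
  by rewrite q0' !mul0r !add0r oppr_le0 mulr_ge0 // ltW.
have qp0 : 0 < q by rewrite lt0r qn0.
have pp0 : 0 < p by rewrite lt0r p0 andbT; apply: contra_neq qn0.
have h : ln c <= ln (q / p) + (c / (q / p) - 1).
  rewrite -lerBlDl -ln_div ?posrE ?divr_gt0 //.
  by apply: ln_le_sub1; rewrite !divr_gt0.
have := ler_wpM2l q0 h; rewrite mulrDr.
have -> : q * (c / (q / p) - 1) = p * c - q by field; rewrite !gt_eqF.
lra.
Qed.

(** Sum the tangent bounds at the ratio of the two totals: the linear terms then cancel. The masses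
    need not be normalised, so it applies to slices of joint laws and to counting measures. *)
Lemma log_sum (I : finType) (q p : I -> R) :
  (forall i, 0 <= q i) -> (forall i, 0 <= p i) -> ac q p ->
  (\sum_i q i) * ln ((\sum_i q i) / (\sum_i p i)) <= kl q p.
Proof.
move=> q0 p0 qp.
have Q0 : 0 <= \sum_i q i by exact: sumr_ge0.
have P0 : 0 <= \sum_i p i by exact: sumr_ge0.
have [Qz|Qn0] := eqVneq (\sum_i q i) 0.
  rewrite Qz mul0r /kl big1 // => i _.
  by rewrite (psumr_eq0P (fun i _ => q0 i) Qz) ?mul0r.
have Pn0 : \sum_i p i != 0.
  apply: contra_neq Qn0 => Pz; rewrite big1 // => i _; apply: qp.
  exact: (psumr_eq0P (fun i _ => p0 i) Pz).
set Q := \sum_i q i in Q0 Qn0 *; set P := \sum_i p i in P0 Pn0 *.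
have c0 : 0 < Q / P by rewrite divr_gt0 // lt0r ?Qn0 ?Pn0.
have : \sum_i (q i * ln (Q / P) + q i - p i * (Q / P)) <= kl q p.
  by apply: ler_sum => i _; apply: log_sum_term => //; exact: qp.
rewrite sumrB big_split /= -!mulr_suml -/Q -/P.
have -> : P * (Q / P) = Q by field.
lra.
Qed.

Lemma klxx (T : finType) (p : T -> R) : (forall x, 0 <= p x) -> kl p p = 0.
Proof.
move=> p0; rewrite /kl big1 // => x _.
have [->|pn0] := eqVneq (p x) 0; first by rewrite mul0r.
by rewrite divff // ln1 mulr0.
Qed.

Lemma entropy_dret (T : finType) (a : T) : entropy (dret R a) = 0.
Proof.
rewrite /entropy big1 ?oppr0 // => x _ /=; case: (x == a); last by rewrite mul0r.
by rewrite ln1 mulr0.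
Qed.

(** The log-sum inequality against the counting measure of [A]. *)
Lemma entropy_le_card (T : finType) (p : dist R T) (A : {set T}) :
  (forall x, x \notin A -> p x = 0) -> entropy p <= ln #|A|%:R.
Proof.
move=> pA.
have h : ac p (fun x => (x \in A)%:R).
  by move=> x; case: (boolP (x \in A)) => [_ /eqP|/pA //]; rewrite oner_eq0.
have := @log_sum T p (fun x => (x \in A)%:R) (Defs.pmf_ge0 p) (fun x => ler0n _ _) h.
have -> : \sum_x (x \in A)%:R = #|A|%:R :> R.
  rewrite -sum1_card natr_sum [RHS]big_mkcond; apply: eq_bigr => x _.
  by case: (x \in A).
rewrite pmf_sum1 !mul1r.
have Agt0 : (0 < #|A|)%N.
  rewrite card_gt0; apply/eqP => A0; have := pmf_sum1 p.
  by rewrite big1 => [/esym/eqP|x _]; rewrite ?oner_eq0 // pA // A0 inE.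
rewrite lnV ?posrE ?ltr0n // => H; rewrite /entropy lerNl.
apply: le_trans H _; apply: ler_sum => x _; have := h x.
case: (x \in A) => [_|-> //]; first by rewrite divr1.
by rewrite !mul0r.
Qed.

(** For each outcome [y], the log-sum inequality between [p x * f x y] and [p x], whose total is
    1. *)
Lemma entropy_concave (T U : finType) (p : dist R T) (f : T -> dist R U) :
  ex p (fun x => entropy (f x)) <= entropy (dbind p f).
Proof.
rewrite /ex /entropy; under eq_bigr do rewrite mulrN mulr_sumr.
rewrite sumrN lerN2 exchange_big; apply: ler_sum => y _ /=.
have h : ac (fun x => p x * f x y) p by move=> x ->; rewrite mul0r.
have := @log_sum T (fun x => p x * f x y) p
   (fun x => mulr_ge0 (Defs.pmf_ge0 _ _) (Defs.pmf_ge0 _ _)) (Defs.pmf_ge0 p) h.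
rewrite pmf_sum1 divr1 => /le_trans; apply; apply: ler_sum => x _ /=.
have [->|pn0] := eqVneq (p x) 0; first by rewrite !mul0r.
by rewrite -mulrA mulrAC divff // mul1r.
Qed.

Lemma ac_dbind (T U : finType) (q p : dist R T) (a b : T -> dist R U) :
  ac q p -> (forall x, ac (a x) (b x)) -> ac (dbind q a) (dbind p b).
Proof.
move=> qp ab y /= h; rewrite big1 // => x _.
have /eqP := psumr_eq0P (fun x _ => mulr_ge0 (Defs.pmf_ge0 p x) (Defs.pmf_ge0 (b x) y))
  h (i := x) isT.
by rewrite mulf_eq0 => /orP[/eqP/qp ->|/eqP/ab ->]; rewrite ?mul0r ?mulr0.
Qed.

(* Chain rule and data processing at once. *)
Lemma kl_dbind (T U : finType) (q p : dist R T) (a b : T -> dist R U) :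
  ac q p -> (forall x, ac (a x) (b x)) ->
  kl (dbind q a) (dbind p b) <= kl q p + ex q (fun x => kl (a x) (b x)).
Proof.
move=> qp ab; rewrite {1}/kl.
apply: (@le_trans _ _ (\sum_y kl (fun x => q x * a x y) (fun x => p x * b x y))).
  apply: ler_sum => y _; apply: log_sum => [x|x|x /eqP].
  - by rewrite mulr_ge0 ?Defs.pmf_ge0.
  - by rewrite mulr_ge0 ?Defs.pmf_ge0.
  - by rewrite mulf_eq0 => /orP[/eqP/qp ->|/eqP/ab ->]; rewrite ?mul0r ?mulr0.
rewrite /kl exchange_big -big_split; apply: ler_sum => x _ /=.
rewrite -[q x * ln _]mulr1 -(pmf_sum1 (a x)) !mulr_sumr -big_split /=.
apply: ler_sum => y _.
have [->|qn0] := eqVneq (q x) 0; first by rewrite !mul0r addr0.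
have [->|an0] := eqVneq (a x y) 0; first by rewrite !(mulr0,mul0r) addr0.
have q0 : 0 < q x by rewrite lt0r qn0 Defs.pmf_ge0.
have a0 : 0 < a x y by rewrite lt0r an0 Defs.pmf_ge0.
have p0 : 0 < p x.
  by rewrite lt0r Defs.pmf_ge0 andbT; apply: contra_neq qn0 => /qp.
have b0 : 0 < b x y.
  by rewrite lt0r Defs.pmf_ge0 andbT; apply: contra_neq an0 => /ab.
rewrite -mulf_div (lnM (x := q x / p x)) ?posrE ?divr_gt0 //.
by rewrite le_eqVlt; apply/orP; left; apply/eqP; ring.
Qed.

(* The tangents t >= (2 + ln t) / e and t >= 1 + ln t to t, applied to the
   likelihood ratio t = p / q with weights f and 1 - f. *)
Lemma kl_test (T : finType) (q p : dist R T) (f : T -> R) :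
  ac q p -> (forall x, 0 <= f x <= 1) ->
  ex q f - kl q p <= 3 * ex p f.
Proof.
move=> qp f01; set e := expR 1 : R.
have e1 : 2 <= e by have := expR_ge1Dx (1 : R); rewrite -/e; lra.
have e4 : e <= 4.
  have h := expR_ge1Dx (- (2^-1) : R).
  have -> : e = ((expR (- (2^-1)))^-1) ^+ 2.
    by rewrite -expRN opprK -expRM_natl; congr expR; lra.
  have {}h : (expR (- (2^-1)) : R)^-1 <= 2.
    by rewrite -[leRHS]invrK lef_pV2 ?posrE ?expR_gt0 ?invr_gt0 //; lra.
  have h0 : 0 <= (expR (- (2^-1)) : R)^-1 by rewrite invr_ge0 expR_ge0.
  by nra.
have ee : ln e = 1 by rewrite expRK.
have term x : f x * q x + q x - e * (p x * f x) - p x + p x * f x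
    <= q x * ln (q x / p x).
  have /andP[f0 f1] := f01 x.
  have := @log_sum_term _ _ 1 (Defs.pmf_ge0 q x) (Defs.pmf_ge0 p x) (qp x) ltr01.
  have := @log_sum_term _ _ e (Defs.pmf_ge0 q x) (Defs.pmf_ge0 p x) (qp x) (expR_gt0 1).
  rewrite ln1 ee => h1 h2.
  have f1' : 0 <= 1 - f x by lra.
  have := lerD (ler_wpM2l f0 h1) (ler_wpM2l f1' h2).
  by nra.
have : \sum_x (f x * q x + q x - e * (p x * f x) - p x + p x * f x) <= kl q p.
  by apply: ler_sum => x _; exact: term.
(* Both laws have mass 1, so what remains is [ex q f - (e - 1) * ex p f <= kl q p]; the factor 3
   comes from [e <= 4]. *)
rewrite big_split /= !sumrB big_split /= !pmf_sum1 -mulr_sumr.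
have -> : \sum_x f x * q x = ex q f by apply: eq_bigr => x _; rewrite mulrC.
rewrite -/(ex p f); have := @ex_ge0 _ _ p f (fun x => proj1 (andP (f01 x))).
nra.
Qed.

End Entropy.

(** * One group: null and planted examples, and the level-1 inequality *)

Section LevelOne.
Context {R : realType}.
Variable d : nat.
Set Implicit Arguments.
Unset Strict Implicit.

Definition labelled : finType := ({ffun 'I_d -> bool} * bool)%type.

Definition chi (i : 'I_d) (w : labelled) : R := if w.1 i == w.2 then 1 else -1.

Lemma chi_bounds i w : -1 <= chi i w <= 1.
Proof. by rewrite /chi; case: ifP => _; rewrite ?lexx ?andbT /=; lra. Qed.

Lemma card_labelled : #|labelled|%:R = 2 ^+ d * 2 :> R.
Proof. by rewrite card_prod card_ffun card_ord !card_bool natrM natrX. Qed.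

(** For either value of the label, the [chi i] are independent fair signs, so the sum over the cube
    factors; the 2 counts the labels. *)
Lemma sum_prod_chi (g : 'I_d -> R -> R) :
  \sum_w \prod_i g i (chi i w) = 2 * \prod_i (g i 1 + g i (-1)).
Proof.
have -> : \sum_w \prod_i g i (chi i w) =
   \sum_(y : bool) \sum_(x : {ffun 'I_d -> bool}) \prod_i g i (chi i (x, y)).
  by rewrite exchange_big pair_big; apply: eq_bigr => -[].
have h (y : bool) : \sum_(x : {ffun 'I_d -> bool}) \prod_i g i (chi i (x, y))
    = \prod_i (g i 1 + g i (-1)).
  rewrite /chi /=.
  rewrite -(bigA_distr_bigA (fun i b => g i (if b == y then 1 else -1))) /=.
  apply: eq_bigr => i _; rewrite big_bool; case: y => //=; exact: addrC.
by rewrite big_bool !h mulr_natl mulr2n.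
Qed.

Lemma sum_chi i : \sum_w chi i w = 0.
Proof.
have := sum_prod_chi (fun j t => if j == i then t else 1).
have -> : \prod_j ((if j == i then 1 else 1) + (if j == i then -1 else 1)) = 0 :> R.
  by rewrite (bigD1 i) //= eqxx subrr mul0r.
rewrite mulr0 => h; rewrite -[RHS]h; apply: eq_bigr => w _.
by rewrite (bigD1 i) //= eqxx big1 ?mulr1 // => j /negbTE ->.
Qed.

(** [None] is a null group and [Some i] one planted at [i]. The factor [1 + chi i w / 2] is 3/2 or
    1/2, which makes the label agree with coordinate [i] with probability 3/4. *)
Definition dens (c : option 'I_d) (w : labelled) : R :=
  (#|labelled|%:R)^-1 * (1 + if c is Some i then chi i w / 2 else 0).

Lemma card_labelled_gt0 : 0 < #|labelled|%:R :> R.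
Proof. by rewrite card_labelled mulr_gt0 ?exprn_gt0. Qed.

Fact dens_ge0 c w : 0 <= dens c w.
Proof.
rewrite mulr_ge0 ?invr_ge0 ?ler0n //; case: c => [i|]; last by lra.
by have := chi_bounds i w; lra.
Qed.

Fact dens_sum1 c : \sum_w dens c w = 1.
Proof.
rewrite -mulr_sumr big_split /= sumr_const; apply: canLR (mulKf _) _.
  by rewrite gt_eqF ?card_labelled_gt0.
rewrite mulr1; case: c => [i|]; last by rewrite big1 ?addr0.
by rewrite -mulr_suml sum_chi mul0r addr0.
Qed.

Definition sample (c : option 'I_d) : dist R labelled :=
  Dist (dens_ge0 c) (dens_sum1 c).

Lemma dens_planted i w : dens (Some i) w = dens None w * (1 + chi i w / 2).
Proof. by rewrite /dens addr0 mulr1. Qed.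

Lemma dens_null w : dens None w = (#|labelled|%:R)^-1.
Proof. by rewrite /dens addr0 mulr1. Qed.

Lemma dens_null_gt0 w : 0 < dens None w.
Proof. by rewrite dens_null invr_gt0 card_labelled_gt0. Qed.

Lemma expR_half_le (b : R) : b <= 2^-1 -> expR b <= 1 + b + 2 * b ^+ 2.
Proof.
move=> hb; have h := expR_ge1Dx (- b).
have h0 : 0 < 1 - b by lra.
have : expR b <= (1 - b)^-1.
  by rewrite -[leLHS]invrK lef_pV2 ?posrE ?invr_gt0 ?expR_gt0 // -expRN.
move/le_trans; apply; rewrite -div1r ler_pdivrMr //.
have : 0 <= b ^+ 2 * (1 - 2 * b) by rewrite mulr_ge0 ?sqr_ge0 //; lra.
rewrite -subr_ge0 => H; rewrite -subr_ge0; move: H; congr (_ <= _); ring.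
Qed.

Lemma cosh_le (b : R) : `|b| <= 2^-1 -> (expR b + expR (- b)) / 2 <= expR (2 * b ^+ 2).
Proof.
rewrite ler_norml => /andP[h1 h2].
have e1 : expR b <= 1 + b + 2 * b ^+ 2 by apply: expR_half_le.
have e2 : expR (- b) <= 1 - b + 2 * b ^+ 2.
  by rewrite -[b ^+ 2]sqrrN; apply: expR_half_le; lra.
by have := expR_ge1Dx (2 * b ^+ 2); lra.
Qed.

(** The moment generating function factors over the coordinates by [sum_prod_chi], and [cosh_le]
    bounds each factor. *)
Lemma subgaussian (b : 'I_d -> R) : (forall i, `|b i| <= 2^-1) ->
  ex (sample None) (fun w => expR (\sum_i b i * chi i w))
    <= expR (2 * \sum_i b i ^+ 2).
Proof.
move=> hb; rewrite /ex; under eq_bigr do rewrite /= dens_null expR_sum.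
rewrite -mulr_sumr (sum_prod_chi (fun i t => expR (b i * t))).
have -> : (#|labelled|%:R)^-1 * (2 * \prod_i (expR (b i * 1) + expR (b i * -1)))
   = \prod_i ((expR (b i) + expR (- b i)) / 2).
  rewrite big_split /= prodr_const card_ord card_labelled exprVn.
  under eq_bigr do rewrite mulr1 mulrN1.
  by field; rewrite expf_neq0.
rewrite mulr_sumr expR_sum; apply: ler_prod => i _; by rewrite cosh_le ?andbT.
Qed.

(** Mutual information between an example drawn from [p] and the output of the channel [l]. *)
Definition info {T : finType} (p : dist R labelled) (l : labelled -> dist R T) : R :=
  entropy (dbind p l) - ex p (fun w => entropy (l w)).

Section Kernel.
Variables (T : finType) (l : labelled -> dist R T).
Let lam r := dbind (sample None) l r.
(** A degree-1 Fourier coefficient: [lam r] times the conditional mean of [chi i] given the output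
    [r]. *)
Let cor i r := ex (sample None) (fun w => chi i w * l w r).

Let lam_ge0 r : 0 <= lam r. Proof. exact: Defs.pmf_ge0. Qed.

Let cor_bounds i r : - lam r <= cor i r <= lam r.
Proof.
rewrite lerNl -subr_ge0 opprK /lam dbindE -exD; apply/andP; split.
  apply: ex_ge0 => w.
  by have := chi_bounds i w; have := Defs.pmf_ge0 (l w) r; nra.
by apply: le_ex => w; have := chi_bounds i w; have := Defs.pmf_ge0 (l w) r; nra.
Qed.

Lemma dbind_planted i r :
  dbind (sample (Some i)) l r = dbind (sample None) l r + cor i r / 2.
Proof.
rewrite !dbindE /cor /ex mulr_suml -big_split /=.
apply: eq_bigr => w _; rewrite /= dens_planted; ring.
Qed.

Let sum_cor i : \sum_r cor i r = 0.
Proof.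
rewrite exchange_big /=.
under eq_bigr => w _ do rewrite -mulr_sumr -mulr_sumr pmf_sum1 mulr1 dens_null.
by rewrite -mulr_sumr sum_chi mulr0.
Qed.

Let cor_div_le i r : cor i r ^+ 2 / lam r <= lam r.
Proof.
have [->|ln0] := eqVneq (lam r) 0; first by rewrite invr0 mulr0.
have l0 : 0 < lam r by rewrite lt0r ln0 lam_ge0.
rewrite ler_pdivrMr // -expr2 -ler_sqrt ?exprn_ge0 // !sqrtr_sqr.
by rewrite [leRHS]ger0_norm // ler_norml cor_bounds.
Qed.

(** Since [cor i r >= - lam r], planting keeps at least half of the null mass at every point. *)
Lemma ac_planted i : ac (dbind (sample None) l) (dbind (sample (Some i)) l).
Proof.
move=> r; rewrite dbind_planted -/(lam r) => h.
by have := cor_bounds i r; have := lam_ge0 r; lra.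
Qed.

(** A chi-square bound, from [ln t <= t - 1]. The linear term [cor i r / 2], whose sum over [r] is
    0, is subtracted to make the comparison hold term by term. *)
Let kl_planted_cor i :
  kl (dbind (sample None) l) (dbind (sample (Some i)) l)
    <= 2^-1 * \sum_r cor i r ^+ 2 / lam r.
Proof.
have -> : 2^-1 * (\sum_r cor i r ^+ 2 / lam r) =
    \sum_r (2^-1 * (cor i r ^+ 2 / lam r) - cor i r / 2).
  by rewrite sumrB -mulr_suml sum_cor mul0r subr0 mulr_sumr.
apply: ler_sum => r _; rewrite dbind_planted -/(lam r).
have := cor_bounds i r; set c := cor i r => cb.
have [l0|ln0] := eqVneq (lam r) 0.
  by move: cb; rewrite l0 !mul0r invr0 mulr0 mulr0; lra.
have l0 : 0 < lam r by rewrite lt0r ln0 lam_ge0.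
have p0 : 0 < lam r + c / 2 by lra.
apply: (@le_trans _ _ (lam r * (lam r / (lam r + c / 2) - 1))).
  by rewrite ler_wpM2l ?lam_ge0 // ln_le_sub1 // divr_gt0.
rewrite -subr_ge0.
have -> : 2^-1 * (c ^+ 2 / lam r) - c / 2 - lam r * (lam r / (lam r + c / 2) - 1)
    = c ^+ 2 * (lam r + c) / (4 * lam r * (lam r + c / 2)).
  by field; rewrite ln0 gt_eqF //; lra.
have lc0 : 0 <= lam r + c by case/andP: cb; lra.
by rewrite divr_ge0 ?(mulr_ge0 (sqr_ge0 _) lc0) // !mulr_ge0 // ltW.
Qed.

Lemma kl_planted_half i :
  kl (dbind (sample None) l) (dbind (sample (Some i)) l) <= 2^-1.
Proof.
apply: le_trans (kl_planted_cor i) _; rewrite -[leRHS]mulr1 ler_pM2l //.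
by rewrite -(pmf_sum1 (dbind (sample None) l)); apply: ler_sum => r _.
Qed.

Let info_sum : info (sample None) l =
  \sum_r \sum_w sample None w * (l w r * ln (l w r / lam r)).
Proof.
have h : \sum_r dbind (sample None) l r * ln (dbind (sample None) l r) =
    \sum_w \sum_r sample None w * l w r * ln (lam r).
  by rewrite exchange_big; apply: eq_bigr => r _; rewrite -mulr_suml.
rewrite /info /entropy h [RHS]exchange_big /ex -sumrN -sumrB.
apply: eq_bigr => w _; rewrite mulrN opprK mulr_sumr -sumrN -big_split.
apply: eq_bigr => r _; rewrite -[LHS]/(- (sample None w * l w r * ln (lam r))
  + sample None w * (l w r * ln (l w r))).
have [->|an0] := eqVneq (l w r) 0; first by rewrite !(mul0r,mulr0) oppr0 addr0.
have a0 : 0 < l w r by rewrite lt0r an0 Defs.pmf_ge0.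
have s0 := dens_null_gt0 w.
have l0 : 0 < lam r.
  rewrite /lam /= (bigD1 w) //= ltr_wpDr ?(mulr_gt0 s0 a0) //.
  by apply: sumr_ge0 => w' _; rewrite mulr_ge0 ?dens_ge0 ?Defs.pmf_ge0.
rewrite ln_div ?posrE //; ring.
Qed.

(* Level-1 inequality: Gibbs' variational principle for the test function that
   weights each [chi i] by its own correlation. *)
Let level1 r : \sum_i cor i r ^+ 2 / lam r <=
  8 * \sum_w sample None w * (l w r * ln (l w r / lam r)).
Proof.
have [l0|ln0] := eqVneq (lam r) 0.
  under eq_bigr do rewrite l0 invr0 mulr0.
  rewrite big1 // big1 ?mulr0 // => w _.
  have s0 := dens_null_gt0 w.
  have := psumr_eq0P (fun w _ => mulr_ge0 (Defs.pmf_ge0 (sample None) w)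
    (Defs.pmf_ge0 (l w) r)) l0 (i := w) isT.
  by move/eqP; rewrite mulf_eq0 gt_eqF //= => /eqP ->; rewrite mul0r mulr0.
have l0 : 0 < lam r by rewrite lt0r ln0 lam_ge0.
(* With [b i = t * cor i r / lam r], the gain minus the subgaussian cost is [t - 2 * t ^ 2] times
   the left-hand side. It is largest at [t = 1/4], where it equals 1/8, whence the constant 8. *)
pose b i := cor i r / (4 * lam r).
have hb i : `|b i| <= 2^-1.
  rewrite normrM normfV ler_pdivrMr ?normr_gt0 ?mulf_neq0 // (gtr0_norm (x := 4 * _)) ?mulr_gt0 //.
  by rewrite ler_norml; have := cor_bounds i r; lra.
pose phi w := \sum_i b i * chi i w.
have := subgaussian hb; rewrite -/phi; set E := ex _ _ => hE.
have E0 : 0 < E.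
  rewrite /E /ex (bigD1 ([ffun=> false], false)) //= ltr_wpDr //.
    by apply: sumr_ge0 => w _; rewrite mulr_ge0 ?dens_ge0 ?expR_ge0.
  by rewrite mulr_gt0 ?dens_null_gt0 ?expR_gt0.
pose q w := sample None w * l w r.
pose p w := sample None w * (lam r * expR (phi w)).
have q0 w : 0 <= q w by rewrite mulr_ge0 ?Defs.pmf_ge0.
have p0 w : 0 < p w by exact: mulr_gt0 (dens_null_gt0 w) (mulr_gt0 l0 (expR_gt0 _)).
have hac : ac q p by move=> w /eqP; rewrite gt_eqF.
have := log_sum q0 (fun w => ltW (p0 w)) hac.
have -> : \sum_w q w = lam r by [].
have -> : \sum_w p w = lam r * E.
  by rewrite -exZ.
have -> : lam r / (lam r * E) = E^-1 by field; rewrite ln0 gt_eqF.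
rewrite lnV ?posrE //.
have -> : kl q p = \sum_w sample None w * (l w r * ln (l w r / lam r))
    - \sum_i b i * cor i r.
  have -> : \sum_i b i * cor i r = \sum_w sample None w * (l w r * phi w).
    under eq_bigr do rewrite mulr_sumr; rewrite exchange_big; apply: eq_bigr => w _.
    by rewrite /phi !mulr_sumr; apply: eq_bigr => i _; ring.
  rewrite -sumrB; apply: eq_bigr => w _; rewrite /q /p /=.
  have [->|an0] := eqVneq (l w r) 0; first by rewrite !(mul0r,mulr0) subrr.
  have a0 : 0 < l w r by rewrite lt0r an0 Defs.pmf_ge0.
  have -> : dens None w * l w r / (dens None w * (lam r * expR (phi w)))
      = (l w r / lam r) / expR (phi w).
    by field; rewrite ln0 !gt_eqF ?expR_gt0 ?dens_null_gt0.
  rewrite (ln_div (x := l w r / lam r)) ?posrE ?divr_gt0 ?expR_gt0 // expRK; ring.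
have -> : \sum_i b i * cor i r = 4^-1 * \sum_i cor i r ^+ 2 / lam r.
  by rewrite mulr_sumr; apply: eq_bigr => i _; rewrite /b; field.
have lE : ln E <= 2 * \sum_i b i ^+ 2.
  by rewrite -[leRHS]expRK ler_ln ?posrE ?expR_gt0.
have hb2 : lam r * (2 * \sum_i b i ^+ 2) = 8^-1 * \sum_i cor i r ^+ 2 / lam r.
  by rewrite !mulr_sumr; apply: eq_bigr => i _; rewrite /b; field.
have := ler_wpM2l (ltW l0) lE; rewrite hb2 mulrN.
set X := \sum_i cor i r ^+ 2 / lam r; set Y := \sum_w _; lra.
Qed.

(** The chi-square bound (factor 1/2) followed by the level-1 inequality (factor 8). The right-hand
    side does not grow with the number of indices, which is the gain of a factor [d] on average over
    [i]. *)
Lemma sum_kl_planted :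
  \sum_i kl (dbind (sample None) l) (dbind (sample (Some i)) l)
    <= 4 * info (sample None) l.
Proof.
apply: (@le_trans _ _ (\sum_i 2^-1 * \sum_r cor i r ^+ 2 / lam r)).
  by apply: ler_sum => i _; exact: kl_planted_cor.
rewrite -mulr_sumr exchange_big info_sum.
have : \sum_r \sum_i cor i r ^+ 2 / lam r <=
    \sum_r 8 * \sum_w sample None w * (l w r * ln (l w r / lam r)).
  by apply: ler_sum => r _; exact: level1.
rewrite -mulr_sumr /=; lra.
Qed.

End Kernel.
End LevelOne.

(** * The state along a fixed sequence of groups: chain rule and information accounting *)

Section Words.
Context {R : realType}.
Set Implicit Arguments.
Unset Strict Implicit.
Variables (G S : finType) (d : nat) (st : G -> labelled d -> S -> dist R S).

Definition Ker (v : G -> option 'I_d) g s : dist R S :=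
  dbind (sample (v g)) (fun z => st g z s).

Fixpoint runw v (w : seq G) s : dist R S :=
  if w is g :: w' then dbind (Ker v g s) (runw v w') else dret R s.

Lemma eq_dbind (T U : finType) (p q : dist R T) (f g : T -> dist R U) :
  p =1 q -> (forall x, f x =1 g x) -> dbind p f =1 dbind q g.
Proof. by move=> pq fg y; apply: eq_bigr => x _; rewrite pq fg. Qed.

Lemma eq_entropy (T : finType) (p q : T -> R) : p =1 q -> entropy p = entropy q.
Proof. by move=> /funext ->. Qed.

Lemma eq_kl (T : finType) (p q p' q' : T -> R) :
  p =1 p' -> q =1 q' -> kl p q = kl p' q'.
Proof. by move=> /funext -> /funext ->. Qed.

Lemma dbind_retr (T : finType) (p : dist R T) : dbind p (@dret R T) =1 p.
Proof.
move=> z; rewrite dbindE /ex (bigD1 z) //= eqxx mulr1 big1 ?addr0 // => u uz.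
by rewrite eq_sym (negbTE uz) mulr0.
Qed.

Lemma runw_cat v w1 w2 s :
  runw v (w1 ++ w2) s =1 dbind (runw v w1 s) (runw v w2).
Proof.
elim: w1 s => [|g w1 IH] s x; first by rewrite dbind_dret.
by rewrite [RHS]dbindA; apply: eq_dbind.
Qed.

Lemma runw_rcons v w g s :
  runw v (rcons w g) s =1 dbind (runw v w s) (Ker v g).
Proof.
move=> x; rewrite -cats1 runw_cat; apply: eq_dbind => // y z.
exact: dbind_retr.
Qed.

Lemma eq_in_runw v v' w s : {in w, v =1 v'} -> runw v w s =1 runw v' w s.
Proof.
elim: w s => [//|g w IH] s vv'.
apply: eq_dbind => [y|y]; last by apply: IH => h hw; rewrite vv' // inE hw orbT.
by rewrite /Ker vv' // inE eqxx.
Qed.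

(** Information kept about an example of group [g], given the state [s] before it, once the groups
    [w] have also been read. *)
Definition step_info v g w s : R :=
  info (sample (v g)) (fun z => dbind (st g z s) (runw v w)).

Lemma step_info_ge0 v g w s : 0 <= step_info v g w s.
Proof. by rewrite subr_ge0 entropy_concave. Qed.

(** Data processing: the final state depends on the example only through the state right after it.
    In this form the bound telescopes along a word. *)
Lemma step_info_le v g w s : step_info v g w s <=
  entropy (runw v (g :: w) s) - ex (Ker v g s) (fun r => entropy (runw v w r)).
Proof.
rewrite /step_info /info; apply: lerB.
  by rewrite le_eqVlt (eq_entropy (q := runw v (g :: w) s)) ?eqxx // => x; rewrite [RHS]dbindA.
by rewrite ex_dbind; apply: le_ex => z; exact: entropy_concave.
Qed.

(* Sum over the occurrences of [j] in [w] of the expectation of a cost depending on the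
   state just before that occurrence and on the letters after it. *)
Fixpoint acc v (c : seq G -> S -> R) j (w : seq G) s : R :=
  if w is g :: w' then
    (if g == j then c w' s else 0) + ex (Ker v g s) (acc v c j w')
  else 0.

Lemma le_acc v c c' j w s : (forall w s, c w s <= c' w s) ->
  acc v c j w s <= acc v c' j w s.
Proof.
move=> cc'; elim: w s => //= g w IH s; rewrite lerD ?le_ex //.
by case: ifP.
Qed.

Lemma acc_ge0 v c j w s : (forall w s, 0 <= c w s) -> 0 <= acc v c j w s.
Proof.
move=> c0; elim: w s => //= g w IH s; rewrite addr_ge0 ?ex_ge0 //.
by case: ifP.
Qed.

Lemma accD v c c' j w s :
  acc v (fun w s => c w s + c' w s) j w s = acc v c j w s + acc v c' j w s.
Proof.
elim: w s => [|g w IH] s /=; first by rewrite addr0.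
rewrite (eq_ex _ IH) exD; case: ifP => _; ring.
Qed.

Lemma accZ v a c j w s : acc v (fun w s => a * c w s) j w s = a * acc v c j w s.
Proof.
elim: w s => [|g w IH] s /=; first by rewrite mulr0.
rewrite (eq_ex _ IH) exZ; case: ifP => _; ring.
Qed.

Lemma acc_sum (I : finType) v (c : I -> seq G -> S -> R) j w s :
  \sum_i acc v (c i) j w s = acc v (fun w s => \sum_i c i w s) j w s.
Proof.
elim: w s => [|g w IH] s /=; first by rewrite big1.
rewrite big_split /= -ex_sum (eq_ex _ IH); congr (_ + _).
by case: ifP => // _; rewrite big1.
Qed.

Lemma acc_cst v a j w s : acc v (fun _ _ => a) j w s = a * (count_mem j w)%:R.
Proof.
elim: w s => [|g w IH] s /=; first by rewrite mulr0.
rewrite (eq_ex _ IH) ex_cst natrD mulrDr; congr (_ + _).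
by case: (g == j); rewrite ?mulr1 ?mulr0.
Qed.

Lemma acc_skip v c j w1 w2 s : j \notin w1 ->
  acc v c j (w1 ++ w2) s = ex (runw v w1 s) (acc v c j w2).
Proof.
elim: w1 s => [|g w1 IH] s /=; first by rewrite ex_dret.
rewrite inE negb_or => /andP[/negbTE jg jw]; rewrite eq_sym jg add0r ex_dbind.
by apply: eq_ex => r; exact: IH.
Qed.

Definition seg (j : G) (w : seq G) := take (index j w) w.

Lemma seg_notin j w : j \notin seg j w.
Proof.
rewrite /seg; elim: w => //= g w IH; case: (eqVneq g j) => //= gj.
by rewrite inE negb_or eq_sym gj.
Qed.

Lemma seg_id j w : j \notin w -> seg j w = w.
Proof. by rewrite /seg -index_mem -leqNgt => /take_oversize. Qed.

(** Each occurrence of [j] is charged with the information about its example that survives until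
    just before the next [j], or until the end of the word. [opn] keeps only the last occurrence,
    still waiting for a successor; [clo] keeps the others. *)
Definition tot v j := acc v (fun w s => step_info v j (seg j w) s) j.
Definition opn v j :=
  acc v (fun w s => if j \in w then 0 else step_info v j w s) j.
Definition clo v j :=
  acc v (fun w s => if j \in w then step_info v j (seg j w) s else 0) j.

Lemma totE v j w s : tot v j w s = clo v j w s + opn v j w s.
Proof.
rewrite -accD; congr (acc v _ j w s); apply/funext => {}w; apply/funext => {}s.
case: ifP => jw; first by rewrite addr0.
by rewrite add0r seg_id // jw.
Qed.

Lemma opn_ge0 v j w s : 0 <= opn v j w s.
Proof. by apply: acc_ge0 => {}w {}s; case: ifP => // _; exact: step_info_ge0. Qed.

Lemma clo_ge0 v j w s : 0 <= clo v j w s.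
Proof. by apply: acc_ge0 => {}w {}s; case: ifP => // _; exact: step_info_ge0. Qed.

(** A new letter [j] closes the open occurrence of [j], whose charge is frozen at its current value;
    occurrences already closed are unaffected. *)
Lemma clo_rcons v j w g s :
  clo v j (rcons w g) s = clo v j w s + (if g == j then opn v j w s else 0).
Proof.
rewrite /clo /opn; elim: w s => [|h w IH] s /=.
  by rewrite ex0 addr0 add0r; case: (g == j).
rewrite (eq_ex _ IH) exD -/(clo v j) -/(opn v j).
have -> : ex (Ker v h s) (fun x => if g == j then opn v j w x else 0) =
   if g == j then ex (Ker v h s) (opn v j w) else 0.
  by case: ifP => // _; exact: ex0.
have segE : j \in w -> seg j (rcons w g) = seg j w.
  by move=> jw; rewrite /seg -cats1 index_cat jw take_cat index_mem jw.
have segE' : j \notin w -> seg j (rcons w j) = w.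
  by move=> /negbTE jw; rewrite /seg -cats1 index_cat jw /= eqxx addn0 take_size_cat.
rewrite mem_rcons inE [j == g]eq_sym; have [gj|gj] := eqVneq g j.
  rewrite gj in segE *; case: (h == j); case: (boolP (j \in w)) => jw /=;
  by rewrite ?(segE jw) ?(segE' jw); ring.
by case: (h == j); case: (boolP (j \in w)) => jw /=; rewrite ?(segE jw); ring.
Qed.

(** Induction from the front of the word: by [step_info_le], what the first example contributes is
    paid for by the entropy that drops when the state after it is revealed. *)
Lemma sum_opn v w s : \sum_j opn v j w s <= entropy (runw v w s).
Proof.
rewrite /opn; elim: w s => [|g w IH] s /=.
  by rewrite big1 // entropy_dret.
rewrite big_split /= -ex_sum.
have := le_ex (Ker v g s) IH; have := step_info_le v g w s; rewrite /=.
have : \sum_j (if g == j then if j \in w then 0 else step_info v j w s else 0)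
    <= step_info v g w s.
  rewrite (bigD1 g) //= eqxx big1 => [|j /negbTE gj]; last by rewrite eq_sym gj.
  by rewrite addr0; case: ifP => // _; exact: step_info_ge0.
lra.
Qed.

(** Sum over all words of length [n], that is [#|G| ^ n] times the mean over uniform words. The last
    letter is summed innermost, to match [clo_rcons]. *)
Fixpoint wsum n (F : seq G -> R) : R :=
  if n is n'.+1 then wsum n' (fun w => \sum_g F (rcons w g)) else F [::].

Lemma le_wsum n F F' : (forall w, size w = n -> F w <= F' w) -> wsum n F <= wsum n F'.
Proof.
elim: n F F' => [|n IH] F F' FF' /=; first exact: FF'.
by apply: IH => w sw; apply: ler_sum => g _; apply: FF'; rewrite size_rcons sw.
Qed.

Lemma eq_wsum n F F' : F =1 F' -> wsum n F = wsum n F'.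
Proof. by move=> /funext ->. Qed.

Lemma wsumD n F F' : wsum n (fun w => F w + F' w) = wsum n F + wsum n F'.
Proof.
elim: n F F' => //= n IH F F'; rewrite -IH; apply: eq_wsum => w.
by rewrite big_split.
Qed.

Lemma wsumZ n a F : wsum n (fun w => a * F w) = a * wsum n F.
Proof.
elim: n F => //= n IH F; rewrite -IH; apply: eq_wsum => w.
by rewrite mulr_sumr.
Qed.

Lemma wsum_cst n a : wsum n (fun=> a) = #|G|%:R ^+ n * a.
Proof.
elim: n a => [|n IH] a /=; first by rewrite mul1r.
by rewrite sumr_const IH exprSr -mulrA [#|_|%:R * a]mulr_natl.
Qed.

Lemma wsum_sum (I : finType) (P : pred I) n (F : I -> seq G -> R) :
  wsum n (fun w => \sum_(i | P i) F i w) = \sum_(i | P i) wsum n (F i).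
Proof.
elim: n F => //= n IH F; rewrite -IH; apply: eq_wsum => w.
by rewrite exchange_big.
Qed.

(** Summed over the [#|G|] possible next letters, each open charge is closed exactly once: a step
    adds on average 1/[#|G|] of the open total, itself at most the entropy before that step. *)
Lemma wsum_clo v s m n :
  (forall w, (size w < n)%N -> entropy (runw v w s) <= m) ->
  #|G|%:R * wsum n (fun w => \sum_j clo v j w s) <= #|G|%:R ^+ n * (n%:R * m).
Proof.
elim: n => [|n IH] hm /=; first by rewrite big1 ?mulr0 ?mul0r ?mulr0.
have -> : wsum n (fun w => \sum_g \sum_j clo v j (rcons w g) s) =
    wsum n (fun w => #|G|%:R * (\sum_j clo v j w s) + \sum_j opn v j w s).
  apply: eq_wsum => w; rewrite exchange_big mulr_sumr -big_split /=.
  apply: eq_bigr => j _; under eq_bigr do rewrite clo_rcons.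
  by rewrite big_split /= sumr_const mulr_natl -big_mkcond big_pred1_eq.
rewrite wsumD wsumZ mulrDr.
have h1 : wsum n (fun w => \sum_j opn v j w s) <= #|G|%:R ^+ n * m.
  rewrite -wsum_cst; apply: le_wsum => w sw.
  by apply: le_trans (sum_opn v w s) _; apply: hm; rewrite sw.
have h2 := IH (fun w sw => hm w (leqW sw)).
have g0 : 0 <= #|G|%:R :> R by [].
have := ler_wpM2l g0 (lerD h2 h1); rewrite exprS mulrDr -natr1; lra.
Qed.

Lemma wsum_tot v s m n :
  (forall w, (size w <= n)%N -> entropy (runw v w s) <= m) ->
  #|G|%:R * wsum n (fun w => \sum_j tot v j w s)
    <= #|G|%:R ^+ n * ((n%:R + #|G|%:R) * m).
Proof.
move=> hm.
have -> : wsum n (fun w => \sum_j tot v j w s) =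
    wsum n (fun w => \sum_j clo v j w s) + wsum n (fun w => \sum_j opn v j w s).
  rewrite -wsumD; apply: eq_wsum => w; rewrite -big_split /=.
  by apply: eq_bigr => j _; exact: totE.
have h2 := wsum_clo (fun w sw => hm w (ltnW sw)).
have h1 : wsum n (fun w => \sum_j opn v j w s) <= #|G|%:R ^+ n * m.
  rewrite -wsum_cst; apply: le_wsum => w sw.
  by apply: le_trans (sum_opn v w s) _; apply: hm; rewrite sw.
have g0 : 0 <= #|G|%:R :> R by [].
have := lerD h2 (ler_wpM2l g0 h1); rewrite -mulrDr; move/le_trans; apply.
by rewrite le_eqVlt; apply/orP; left; apply/eqP; ring.
Qed.

Section Planting.
Variables (v : G -> option 'I_d) (j : G).
Hypothesis vj : v j = None.

Definition plant i : G -> option 'I_d := fun g => if g == j then Some i else v g.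

Let Ker_plant i g s : g != j -> Ker (plant i) g s = Ker v g s.
Proof. by move=> /negbTE gj; rewrite /Ker /plant gj. Qed.

Let ac_Ker i g s : ac (Ker v g s) (Ker (plant i) g s).
Proof.
have [->|gj] := eqVneq g j; last by rewrite Ker_plant.
by rewrite /Ker /plant eqxx vj; exact: ac_planted.
Qed.

Lemma ac_runw i w s : ac (runw v w s) (runw (plant i) w s).
Proof. by elim: w s => [|g w IH] s //; apply: ac_dbind. Qed.

(** Divergence just before the next [j], or at the end of the word, when only the example at the
    present occurrence is planted. *)
Let cost i w s := kl (dbind (sample None) (fun z => dbind (st j z s) (runw v (seg j w))))
  (dbind (sample (Some i)) (fun z => dbind (st j z s) (runw v (seg j w)))).

(** Chain rule with one block per occurrence of [j]. The induction is on the length, since after an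
    occurrence it jumps over the whole segment before the next one. *)
Let kl_runw_cost i w s : kl (runw v w s) (runw (plant i) w s) <= acc v (cost i) j w s.
Proof.
have [n] := ubnP (size w); elim: n w s => // n IH [|g w] s.
  by move=> _; rewrite /= klxx // => x; exact: Defs.pmf_ge0.
rewrite ltnS -/(size w) => sw.
change (kl (dbind (Ker v g s) (runw v w)) (dbind (Ker (plant i) g s) (runw (plant i) w))
  <= (if g == j then cost i w s else 0) + ex (Ker v g s) (acc v (cost i) j w)).
 have [->|gj] := eqVneq g j; last first.
  rewrite add0r Ker_plant //; apply: le_trans (kl_dbind _ _) _ => //.
    by move=> r; exact: ac_runw.
  rewrite klxx ?add0r => [|x]; last exact: Defs.pmf_ge0.
  by apply: le_ex => r; exact: IH.
set a := seg j w; set w2 := drop (index j w) w.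
have wE : w = a ++ w2 by rewrite cat_take_drop.
have ja : j \notin a by exact: seg_notin.
have split u : dbind (Ker u j s) (runw u w) =1
    dbind (dbind (Ker u j s) (runw u a)) (runw u w2).
  move=> x; rewrite wE [RHS]dbindA; apply: eq_dbind => // y z; exact: runw_cat.
(* The segment contains no [j], so planting does not affect its kernels: the divergence of this
   block comes from its first example alone. *)
have va i' : dbind (Ker (plant i') j s) (runw (plant i') a) =1
    dbind (Ker (plant i') j s) (runw v a).
  apply: eq_dbind => // r; apply: eq_in_runw => h ha; rewrite /plant ifN //.
  by apply: contraNneq ja => <-.
rewrite (eq_kl (split v) (split (plant i))).
rewrite (eq_kl (p' := dbind (dbind (Ker v j s) (runw v a)) (runw v w2))
  (q' := dbind (dbind (Ker (plant i) j s) (runw v a)) (runw (plant i) w2))) //;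
  last by apply: eq_dbind.
apply: le_trans (kl_dbind _ _) _.
- by apply: ac_dbind => [|r x //]; exact: ac_Ker.
- by move=> r; exact: ac_runw.
apply: lerD.
  rewrite le_eqVlt (eq_kl (p' := dbind (sample None) (fun z => dbind (st j z s) (runw v a)))
   (q' := dbind (sample (Some i)) (fun z => dbind (st j z s) (runw v a)))) ?eqxx //.
    by move=> x; rewrite [LHS]dbindA vj.
  by move=> x; rewrite [LHS]dbindA /plant eqxx.
rewrite ex_dbind; apply: le_ex => r.
rewrite [in leRHS]wE acc_skip //; apply: le_ex => r'; apply: IH.
by apply: leq_trans sw; rewrite ltnS size_drop leq_subr.
Qed.

Lemma sum_kl_runw_info w s :
  \sum_i kl (runw v w s) (runw (plant i) w s) <= 4 * tot v j w s.
Proof.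
apply: (@le_trans _ _ (\sum_i acc v (cost i) j w s)).
  by apply: ler_sum => i _; exact: kl_runw_cost.
rewrite acc_sum -accZ; apply: le_acc => {}w {}s.
by rewrite /step_info vj; exact: sum_kl_planted.
Qed.

(** A bound that ignores the memory: one planted example costs at most 1/2 for each index. It serves
    to show that the stream cannot be much shorter than [k]. *)
Lemma sum_kl_runw_count w s :
  \sum_i kl (runw v w s) (runw (plant i) w s) <= d%:R / 2 * (count_mem j w)%:R.
Proof.
apply: (@le_trans _ _ (\sum_i acc v (cost i) j w s)).
  by apply: ler_sum => i _; exact: kl_runw_cost.
rewrite acc_sum -(acc_cst v _ j w s); apply: le_acc => {}w {}s.
apply: (@le_trans _ _ (\sum_(i < d) 2^-1)).
  by apply: ler_sum => i _; exact: kl_planted_half.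
by rewrite sumr_const card_ord mulr_natl.
Qed.

End Planting.
End Words.

(** * Errors on the hard instances, and averaging over the hidden coins *)

Section Hypotheses.
Context {R : realType}.
Set Implicit Arguments.
Unset Strict Implicit.
Variables (k d : nat).
Hypothesis k0 : (0 < k)%N.

Let kR0 : 0 < k%:R :> R. Proof. by rewrite ltr0n. Qed.

Fact unif_ge0 (j : 'I_k) : 0 <= (k%:R)^-1 :> R.
Proof. by rewrite invr_ge0. Qed.

Fact unif_sum1 : \sum_(j < k) (k%:R)^-1 = 1 :> R.
Proof. by rewrite sumr_const card_ord -[LHS]mulr_natl mulfV ?gt_eqF. Qed.

Definition unif : dist R 'I_k := Dist unif_ge0 unif_sum1.

Lemma ex_unif f : ex unif f = (k%:R)^-1 * \sum_j f j.
Proof. by rewrite /ex mulr_sumr. Qed.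

Definition glue (j : 'I_k) (w : labelled d) : ds_input k d * bool := ((j, w.1), w.2).

Definition population (v : 'I_k -> option 'I_d) : dist R (ds_input k d * bool)%type :=
  dbind unif (fun j => dbind (sample (v j)) (fun w => dret R (glue j w))).

Lemma ex_population v f :
  ex (population v) f = ex unif (fun j => ex (sample (v j)) (fun w => f (glue j w))).
Proof.
rewrite ex_dbind; apply: eq_ex => j; rewrite ex_dbind; apply: eq_ex => w.
exact: ex_dret.
Qed.

(** Under the null law the label is a fair coin given [x], so only the sum over the two labels
    matters. *)
Lemma ex_null_fiber (f f' : labelled d -> R) :
  (forall x, f (x, true) + f (x, false) = f' (x, true) + f' (x, false)) ->
  ex (sample None) f = ex (sample None) f'.
Proof.
move=> ff'.
have h (F : labelled d -> R) : ex (sample None) F =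
    (#|labelled d|%:R)^-1 * \sum_x (F (x, true) + F (x, false)).
  rewrite /ex; under eq_bigr do rewrite /= dens_null.
  rewrite -mulr_sumr; congr (_ * _).
  transitivity (\sum_(x : {ffun 'I_d -> bool}) \sum_(y : bool) F (x, y)).
    by rewrite pair_big; apply: eq_bigr => -[].
  by apply: eq_bigr => x _; rewrite big_bool.
by rewrite !h; congr (_ * _); apply: eq_bigr.
Qed.

Definition dis (j : 'I_k) (i : 'I_d) (h : ds_input k d -> bool) : R :=
  ex (sample None) (fun w => (h (j, w.1) != w.1 i)%:R).

Lemma dis_ge0 j i h : 0 <= dis j i h.
Proof. exact: ex_ge0. Qed.

Lemma group_err_null j (h : ds_input k d -> bool) :
  ex (sample None) (fun w : labelled d => (h (j, w.1) != w.2)%:R) = 2^-1 :> R.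
Proof.
rewrite -[RHS](ex_cst (sample (d := d) None)); apply: ex_null_fiber => x /=.
by case: (h _); rewrite /= ?add0r ?addr0; lra.
Qed.

(** The conditional error is 1/4 where [h] agrees with coordinate [i] and 3/4 where it does not. *)
Lemma group_err_planted i j (h : ds_input k d -> bool) :
  ex (sample (Some i)) (fun w : labelled d => (h (j, w.1) != w.2)%:R)
    = 4^-1 + dis j i h / 2.
Proof.
have -> : 4^-1 + dis j i h / 2 =
    ex (sample None) (fun w => 4^-1 + 2^-1 * (h (j, w.1) != w.1 i)%:R).
  by rewrite exD ex_cst exZ /dis; ring.
have -> : ex (sample (Some i)) (fun w : labelled d => (h (j, w.1) != w.2)%:R) =
    ex (sample None) (fun w => (1 + chi i w / 2) * (h (j, w.1) != w.2)%:R) :> R.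
  by apply: eq_bigr => w _; rewrite /= dens_planted mulrA.
apply: ex_null_fiber => x; rewrite /chi /=.
by case: (h _); case: (x i); rewrite /=; lra.
Qed.

Lemma err_population v h : err (population v) h = (k%:R)^-1 *
  \sum_j (if v j is Some i then 4^-1 + dis j i h / 2 else 2^-1).
Proof.
rewrite /err PrE ex_population ex_unif; congr (_ * _); apply: eq_bigr => j _.
by case: (v j) => [i|] /=; rewrite ?group_err_planted ?group_err_null.
Qed.

Definition good j i h := dis j i h < 4^-1.

Lemma ex_chi2 (i i' : 'I_d) : i != i' -> ex (sample None) (fun w => chi i w * chi i' w) = 0 :> R.
Proof.
move=> ii'; rewrite /ex; under eq_bigr do rewrite /= dens_null.
rewrite -mulr_sumr.
have -> : \sum_w chi i w * chi i' w =
    \sum_w \prod_j (if (j == i) || (j == i') then chi j w else 1 : R).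
  apply: eq_bigr => w _; rewrite (bigD1 i) //= eqxx (bigD1 i') 1?eq_sym //= eqxx orbT.
  by rewrite big1 ?mulr1 // => j /andP[/negbTE -> /negbTE ->].
rewrite (sum_prod_chi (fun j t => if (j == i) || (j == i') then t else 1)).
by rewrite (bigD1 i) //= eqxx subrr mul0r !mulr0.
Qed.

(** Two distinct coordinates differ with probability 1/2, so by the triangle inequality no function
    is within 1/4 of both. *)
Lemma good_unique j h i i' : good j i h -> good j i' h -> i = i'.
Proof.
move=> hi hi'; apply/eqP; apply: contraT => ii'.
have : 2^-1 <= dis j i h + dis j i' h.
  rewrite /dis -exD.
  have -> : 2^-1 = ex (sample None) (fun w => 2^-1 - 2^-1 * (chi i w * chi i' w)) :> R.
    by rewrite exB ex_cst exZ ex_chi2 // mulr0 subr0.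
  apply: le_ex => w; rewrite /chi.
  by case: (h _); case: (w.1 i); case: (w.1 i'); case: (w.2); rewrite /=; lra.
by move: hi hi'; rewrite /good; lra.
Qed.

Lemma sum_good j h : \sum_i (good j i h)%:R <= 1 :> R.
Proof.
case: (pickP (fun i => good j i h)) => [i hi|h0]; last first.
  by rewrite big1 // => i _; rewrite h0.
rewrite (bigD1 i) //= big1 ?addr0 => [|i' ii']; first by case: (good j i h).
case: (boolP (good j i' h)) => // hi'.
by move: ii'; rewrite (good_unique hi' hi) eqxx.
Qed.

(** An index is drawn for null groups as well, so the instances form a product space and averages
    over them are plain sums. *)
Definition coins : finType := {ffun 'I_k -> bool * 'I_d}.

Definition target (u : coins) j : option 'I_d := if (u j).1 then Some (u j).2 else None.

Definition upd (u : coins) j c : coins := [ffun g => if g == j then c else u g].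

Lemma upd_same u j c : upd u j c j = c.
Proof. by rewrite ffunE eqxx. Qed.

Lemma target_upd u j i : target (upd u j (true, i)) = plant (target u) j i.
Proof.
by apply/funext => g; rewrite /target /plant ffunE; case: (g == j).
Qed.

(** Resampling the coin of [j] preserves the uniform law: exchanging the old and the new coin is an
    involution. *)
Lemma sum_upd j (F : coins -> R) :
  \sum_u \sum_c F (upd u j c) = (2 * d%:R) * \sum_u F u.
Proof.
have -> : 2 * d%:R = #|{: bool * 'I_d}|%:R :> R.
  by rewrite card_prod card_bool card_ord natrM.
rewrite mulr_sumr.
under [RHS]eq_bigr => u _ do rewrite mulr_natl -sumr_const.
rewrite !pair_big /=.
pose f (p : coins * (bool * 'I_d)) := (upd p.1 j p.2, p.1 j).
have fK : involutive f.
  move=> [u c]; rewrite /f /= upd_same; congr (_, _); apply/ffunP => g.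
  by rewrite !ffunE; case: eqP => // ->.
rewrite [RHS](reindex_inj (inv_inj fK)) /=.
by apply: eq_bigl => -[].
Qed.

(** Planting a null group at a random index yields a random instance in which it is planted. This
    links the divergence bounds, which start from a null group, to the learning guarantee, which
    concerns planted ones. *)
Lemma sum_null_upd j (F : coins -> R) : (0 < d)%N ->
  \sum_(u : coins | ~~ (u j).1) \sum_i F (upd u j (true, i))
    = d%:R * \sum_(u : coins | (u j).1) F u.
Proof.
move=> d0; have updupd u c c' : upd (upd u j c) j c' = upd u j c'.
  by apply/ffunP => g; rewrite !ffunE; case: (g == j).
pose H u := \sum_i F (upd u j (true, i)).
have d2 : 2 * d%:R != 0 :> R by rewrite mulf_neq0 // pnatr_eq0 -lt0n.
apply: (mulfI d2); rewrite mulrCA.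
have -> : \sum_(u : coins | (u j).1) F u =
    \sum_(u : coins) (if (u j).1 then F u else 0) by exact: big_mkcond.
have -> : \sum_(u : coins | ~~ (u j).1) \sum_i F (upd u j (true, i))
    = \sum_(u : coins) (if ~~ (u j).1 then H u else 0) by exact: big_mkcond.
rewrite -!(sum_upd j) mulr_sumr; apply: eq_bigr => u _.
have E (K : bool * 'I_d -> R) : \sum_c K c = \sum_i (K (true, i) + K (false, i)).
  transitivity (\sum_(b : bool) \sum_i K (b, i)).
    by rewrite pair_big; apply: eq_bigr => -[].
  by rewrite big_bool -big_split.
rewrite !E.
have HE i : H (upd u j (false, i)) = H u.
  by rewrite /H; apply: eq_bigr => i' _; rewrite updupd.
under [LHS]eq_bigr do rewrite !upd_same /= add0r HE.
rewrite sumr_const card_ord -[LHS]mulr_natl; congr (_ * _).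
by apply: eq_bigr => i _; rewrite !upd_same /= addr0.
Qed.

Lemma sum_null_card : (0 < d)%N ->
  \sum_(u : coins) \sum_(j | ~~ (u j).1) 1 = #|coins|%:R * k%:R / 2 :> R.
Proof.
move=> d0; rewrite (exchange_big_dep predT) //=.
have h j : \sum_(u : coins | ~~ (u j).1) 1 = \sum_(u : coins | (u j).1) 1 :> R.
  have := sum_null_upd j (fun=> 1 : R) d0.
  under eq_bigr do rewrite sumr_const card_ord -[_ *+ _]mulr_natl.
  by rewrite -mulr_sumr => /(mulfI _); apply; rewrite pnatr_eq0 -lt0n.
have h2 j : \sum_(u : coins | ~~ (u j).1) 1 = #|coins|%:R / 2 :> R.
  have : \sum_(u : coins) 1 = #|coins|%:R :> R by rewrite sumr_const.
  by rewrite (bigID (fun u : coins => (u j).1)) /= -h; lra.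
by under eq_bigr do rewrite h2; rewrite sumr_const card_ord -mulr_natl; ring.
Qed.

End Hypotheses.

(** * Lower bounds for a Markov chain whose final state gives a good hypothesis *)

Section LowerBound.
Context {R : realType}.
Set Implicit Arguments.
Unset Strict Implicit.
Variables (k d : nat) (S : finType).
Hypothesis k0 : (0 < k)%N.
Variables (st : 'I_k -> labelled d -> S -> dist R S) (s0 : S).
Variable hyp : S -> ds_input k d -> bool.

Let kR0 : 0 < k%:R :> R. Proof. by rewrite ltr0n. Qed.

Definition mix v s : dist R S := dbind (unif k0) (fun g => Ker st v g s).

Fixpoint law v n : dist R S :=
  if n is n'.+1 then dbind (law v n') (mix v) else dret R s0.

Lemma ex_law v n f :
  k%:R ^+ n * ex (law v n) f = wsum n (fun w => ex (runw st v w s0) f).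
Proof.
elim: n f => [|n IH] f; first by rewrite mul1r.
rewrite /= ex_dbind exprSr -mulrA mulrCA IH -wsumZ; apply: eq_wsum => w.
rewrite -exZ.
have -> : \sum_g ex (runw st v (rcons w g) s0) f =
    \sum_g ex (runw st v w s0) (fun s => ex (Ker st v g s) f).
  by apply: eq_bigr => g _; rewrite -ex_dbind; apply: eq_exl; exact: runw_rcons.
rewrite -ex_sum; apply: eq_ex => s; rewrite ex_dbind ex_unif mulrA mulfV ?mul1r //.
by rewrite gt_eqF.
Qed.

Definition fail v (j : 'I_k) i T : R :=
  ex (law v T.+1) (fun s => (~~ good (R := R) j i (hyp s))%:R).

(** The stream has [T.+1] examples, but entropy is controlled only up to the state after [T] of
    them. The last transition is therefore made part of the test function given to [kl_test]. *)
Let last v j i s : R := ex (mix v s) (fun s' => (~~ good (R := R) j i (hyp s'))%:R).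

Let last01 v j i s : 0 <= last v j i s <= 1.
Proof. by rewrite /last ex_ind_le1 andbT ex_ge0. Qed.

(** The last example may be planted too, but a planted density is at most 3/2 times the null one. As
    a hypothesis is good for at most one index, the success probabilities add up to at most 3/2. *)
Let sum_last v j s : v j = None -> d%:R - 2 <= \sum_i last (plant v j i) j i s.
Proof.
move=> vj.
pose q i s' : R := (good (R := R) j i (hyp s'))%:R.
have h i : 1 - 3 / 2 * ex (mix v s) (q i) <= last (plant v j i) j i s.
  have -> : last (plant v j i) j i s = 1 - ex (mix (plant v j i) s) (q i).
    rewrite -[X in X - _](ex_cst (mix (plant v j i) s)) -exB; apply: eq_ex => s'.
    by rewrite /q; case: (good _ _ _); rewrite ?subr0 ?subrr.
  rewrite lerB // !ex_dbind -exZ; apply: le_ex => g.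
  rewrite !ex_dbind -exZ /ex; apply: ler_sum => z _.
  rewrite mulrCA mulrA ler_wpM2r //.
    by apply: sumr_ge0 => s' _; rewrite mulr_ge0 ?Defs.pmf_ge0.
  have zz := dens_ge0 (R := R) (v g) z.
  rewrite /plant; have [->|_] /= := eqVneq g j; last by lra.
  rewrite vj dens_planted; have := chi_bounds (R := R) i z.
  by have := dens_null_gt0 (R := R) z; nra.
apply: (@le_trans _ _ (\sum_(i < d) (1 - 3 / 2 * ex (mix v s) (q i)))); last exact: ler_sum.
rewrite sumrB sumr_const card_ord -mulr_sumr -ex_sum.
have : ex (mix v s) (fun s' => \sum_i q i s') <= 1.
  by rewrite -[leRHS](ex_cst (mix v s)); apply: le_ex => s'; exact: sum_good.
lra.
Qed.

(** On a run where [j] is null, almost all indices fail; for each word of groups, [kl_test] carries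
    this over to the planted runs. *)
Lemma sum_fail_plant v j T : v j = None ->
  d%:R - 2 - (k%:R ^+ T)^-1 *
    wsum T (fun w => \sum_i kl (runw st v w s0) (runw st (plant v j i) w s0))
  <= 3 * \sum_i fail (plant v j i) j i T.
Proof.
move=> vj; have kT0 : 0 < k%:R ^+ T :> R by rewrite exprn_gt0.
rewrite -(ler_pM2l kT0) mulrBr mulrA mulfV ?gt_eqF // mul1r lerBlDr.
have -> : k%:R ^+ T * (3 * \sum_i fail (plant v j i) j i T) =
    wsum T (fun w => \sum_i 3 * ex (runw st (plant v j i) w s0) (last (plant v j i) j i)).
  rewrite wsum_sum mulrCA mulr_sumr mulr_sumr; apply: eq_bigr => i _.
  by rewrite wsumZ -ex_law /fail /= ex_dbind.
have := wsum_cst (R := R) 'I_k T (d%:R - 2); rewrite card_ord => <-.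
rewrite -wsumD; apply: le_wsum => w _; rewrite -big_split /=.
apply: (@le_trans _ _ (\sum_i ex (runw st v w s0) (last (plant v j i) j i))).
  rewrite -ex_sum -[leLHS](ex_cst (runw st v w s0)); apply: le_ex => s.
  exact: sum_last.
apply: ler_sum => i _; rewrite -lerBlDr; apply: kl_test => //.
exact: ac_runw.
Qed.

Variables (eps0 beta0 : R).

(** Compared with the hidden dictators, the excess error is the sum of [dis / 2] over the planted
    groups, divided by [k]. Each missed index contributes at least 1/8 to that sum, so a successful
    output misses at most [8 * k * eps0]; an unsuccessful one misses at most [k]. *)
Lemma sum_fail_le (u : coins k d) T :
  1 - beta0 <= Pr (law (target u) T.+1) (fun s => err (population k0 (target u)) (hyp s)
     <= inf [set err (population k0 (target u)) h | h in @HDS k d] + eps0) ->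
  0 <= eps0 ->
  \sum_(j | (u j).1) fail (target u) j (u j).2 T <= k%:R * (8 * eps0 + beta0).
Proof.
move=> hL e0; set P := population k0 (target u) in hL *.
pose best : R := (k%:R)^-1 * \sum_(j < k) (if (u j).1 then 4^-1 else 2^-1).
have hinf : inf [set err P h | h in @HDS k d] <= best.
  apply: ge_inf.
    by exists 0 => _ [h _ <-]; rewrite /err PrE; exact: ex_ge0.
  exists (ds_dictator (fun j => (u j).2)); first by exists (fun j => (u j).2).
  rewrite err_population /best; congr (_ * _); apply: eq_bigr => j _.
  rewrite /target; case: ifP => // _.
  rewrite (_ : dis _ _ _ = 0) ?mul0r ?addr0 // /dis -[RHS](ex0 (sample (d := d) None)).
  by apply: eq_ex => w; rewrite /ds_dictator /= eqxx.
have hbad h : err P h <= inf [set err P h | h in @HDS k d] + eps0 ->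
    \sum_(j | (u j).1) (~~ good (R := R) j (u j).2 h)%:R <= k%:R * (8 * eps0).
  move=> hh; have {}hh : err P h <= best + eps0 by lra.
  have hs : \sum_(j < k | (u j).1) dis j (u j).2 h / 2 <= k%:R * eps0.
    have -> : \sum_(j < k | (u j).1) dis j (u j).2 h / 2 = k%:R * (err P h - best).
      rewrite err_population /best -mulrBr mulrA mulfV ?gt_eqF // mul1r -sumrB.
      rewrite big_mkcond; apply: eq_bigr => j _; rewrite /target.
      by case: ifP => _; rewrite ?subrr // addrC addKr.
    by rewrite ler_pM2l //; lra.
  have : \sum_(j | (u j).1) (~~ good (R := R) j (u j).2 h)%:R <=
      \sum_(j < k | (u j).1) 8 * (dis j (u j).2 h / 2) :> R.
    apply: ler_sum => j _; have := dis_ge0 (R := R) j (u j).2 h.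
    by move=> dis0; rewrite /good; case: (ltP (dis j (u j).2 h)) => /=; lra.
  rewrite -mulr_sumr; lra.
rewrite /fail -ex_sum; set ok := (X in Pr _ X) in hL.
apply: (@le_trans _ _ (ex (law (target u) T.+1)
   (fun s => k%:R * (8 * eps0) + k%:R * (1 - (ok s)%:R)))).
  apply: le_ex => s; case: (boolP (ok s)) => [/hbad hb|_] /=; first by rewrite subrr mulr0 addr0.
  have : \sum_(j | (u j).1) (~~ good (R := R) j (u j).2 (hyp s))%:R <= k%:R :> R.
    apply: (@le_trans _ _ (\sum_(j < k) 1)); last by rewrite sumr_const card_ord.
    by rewrite big_mkcond; apply: ler_sum => j _; case: ifP => _ //; case: (good _ _ _).
  have : 0 <= k%:R * (8 * eps0) by rewrite mulr_ge0 // mulr_ge0.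
  by rewrite subr0 mulr1; lra.
rewrite exD ex_cst exZ exB ex_cst -PrE.
by have := ler_wpM2l (ltW kR0) hL; lra.
Qed.

Lemma count_bound (w : seq 'I_k) : \sum_j (count_mem j w)%:R = (size w)%:R :> R.
Proof.
elim: w => [|g w IH] /=; first by rewrite big1.
under eq_bigr do rewrite natrD.
rewrite big_split /= IH -natr1 addrC; congr (_ + _).
rewrite (bigD1 g) //= eqxx big1 ?addr0 // => j /negbTE gj.
by rewrite eq_sym gj.
Qed.

Variables (T : nat) (m : R).
Hypothesis d4 : (4 <= d)%N.
Hypothesis learns : forall u : coins k d,
  1 - beta0 <= Pr (law (target u) T.+1) (fun s => err (population k0 (target u)) (hyp s)
     <= inf [set err (population k0 (target u)) h | h in @HDS k d] + eps0).
Hypothesis e0 : 0 <= eps0.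

(** Average over all coins: [sum_fail_plant] bounds the failures from below, [sum_null_upd] turns
    them into failures on planted groups, and [sum_fail_le] bounds those from above. Half of the
    groups are null on average, and [(d - 2) / 2 >= d / 4] as [d >= 4]. *)
Let key E : (forall v (J : pred 'I_k), (forall j, J j -> v j = None) ->
    \sum_(j | J j) (k%:R ^+ T)^-1 *
      wsum T (fun w => \sum_i kl (runw st v w s0) (runw st (plant v j i) w s0)) <= E) ->
  k%:R * d%:R / 4 - E <= 3 * d%:R * (k%:R * (8 * eps0 + beta0)).
Proof.
move=> hE; have d0 : (0 < d)%N by apply: leq_trans d4.
pose G j (u : coins k d) := fail (target u) j (u j).2 T.
have h1 : \sum_(u : coins k d) (\sum_(j | ~~ (u j).1) (d%:R - 2) - E) <=
    3 * \sum_(u : coins k d) \sum_(j | ~~ (u j).1) \sum_i G j (upd u j (true, i)).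
  rewrite mulr_sumr; apply: ler_sum => u _.
  have hu j : ~~ (u j).1 -> target u j = None by rewrite /target => /negbTE ->.
  have := hE (target u) (fun j => ~~ (u j).1) hu.
  have : \sum_(j | ~~ (u j).1) (d%:R - 2 - (k%:R ^+ T)^-1 *
      wsum T (fun w => \sum_i kl (runw st (target u) w s0) (runw st (plant (target u) j i) w s0)))
     <= \sum_(j | ~~ (u j).1) 3 * \sum_i G j (upd u j (true, i)).
    apply: ler_sum => j /hu uj; apply: le_trans (sum_fail_plant T uj) _.
    rewrite ler_pM2l // le_eqVlt; apply/orP; left; apply/eqP; apply: eq_bigr => i _.
    by rewrite /G upd_same target_upd.
  rewrite sumrB -mulr_sumr; lra.
have h2 : \sum_(u : coins k d) \sum_(j | ~~ (u j).1) \sum_i G j (upd u j (true, i)) =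
    d%:R * \sum_(u : coins k d) \sum_(j | (u j).1) G j u.
  rewrite (exchange_big_dep predT) //= [in RHS](exchange_big_dep predT) //= mulr_sumr.
  by apply: eq_bigr => j _; exact: sum_null_upd.
have h3 : \sum_(u : coins k d) \sum_(j | (u j).1) G j u <=
    #|coins k d|%:R * (k%:R * (8 * eps0 + beta0)).
  rewrite mulr_natl -sumr_const; apply: ler_sum => u _; exact: sum_fail_le.
have h4 : \sum_(u : coins k d) \sum_(j | ~~ (u j).1) (d%:R - 2) =
    (d%:R - 2) * (#|coins k d|%:R * k%:R / 2) :> R.
  rewrite -(sum_null_card (R := R) k d0) mulr_sumr; apply: eq_bigr => u _.
  by rewrite mulr_sumr; apply: eq_bigr => j _; rewrite mulr1.
have U0 : 0 < #|coins k d|%:R :> R.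
  rewrite ltr0n; apply/card_gt0P; exists [ffun=> (true, Ordinal d0)]; by [].
move: h1; rewrite sumrB h4 h2 sumr_const -[E *+ _]mulr_natl => h1.
have hd : (4 : R) <= d%:R by rewrite ler_nat.
have h5 := ler_wpM2l (ler0n R d) h3.
rewrite -(ler_pM2l U0).
have h6 : 0 <= #|coins k d|%:R * k%:R * (d%:R / 2 - 2) :> R.
  by apply: mulr_ge0; [exact: mulr_ge0 | lra].
set U := #|coins k d|%:R in h1 h5 h6 U0 *; set F := \sum_(u : coins k d) _ in h1 h5.
lra.
Qed.

(** Forces [T] to be at least a constant fraction of [k], so that the [k] in the factor [T + k] of
    [space_bound] can be absorbed. *)
Lemma length_bound : k%:R * d%:R / 4 - d%:R / 2 * T%:R
  <= 3 * d%:R * (k%:R * (8 * eps0 + beta0)).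
Proof.
have kT0 : 0 < k%:R ^+ T :> R by rewrite exprn_gt0.
apply: key => v J hJ; rewrite -mulr_sumr -wsum_sum ler_pdivrMl //.
have := wsum_cst (R := R) 'I_k T (d%:R / 2 * T%:R); rewrite card_ord => <-.
apply: le_wsum => w sw; rewrite -sw -count_bound mulr_sumr [leRHS](bigID J) /=.
apply: ler_wpDr; first by apply: sumr_ge0 => j _; rewrite !mulr_ge0 ?invr_ge0.
by apply: ler_sum => j /hJ vj; exact: sum_kl_runw_count.
Qed.

Hypothesis entropy_le : forall v w, (size w <= T)%N -> entropy (runw st v w s0) <= m.

Lemma space_bound : k%:R * d%:R / 4 - 4 * m * (T%:R + k%:R) / k%:R
  <= 3 * d%:R * (k%:R * (8 * eps0 + beta0)).
Proof.
have kT0 : 0 < k%:R ^+ T :> R by rewrite exprn_gt0.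
apply: key => v J hJ; rewrite -mulr_sumr -wsum_sum ler_pdivrMl //.
have h := wsum_tot (fun w sw => entropy_le v sw); rewrite card_ord in h.
rewrite -(ler_pM2l kR0).
apply: (@le_trans _ _ (k%:R * (4 * wsum T (fun w => \sum_j tot st v j w s0)))).
  rewrite ler_pM2l // -wsumZ; apply: le_wsum => w _.
  rewrite mulr_sumr [leRHS](bigID J) /=; apply: ler_wpDr.
    apply: sumr_ge0 => j _; rewrite mulr_ge0 // totE addr_ge0 ?clo_ge0 ?opn_ge0 //.
  by apply: ler_sum => j /hJ vj; exact: sum_kl_runw_info.
rewrite mulrCA.
have -> : k%:R * (k%:R ^+ T * (4 * m * (T%:R + k%:R) / k%:R)) =
  4 * (k%:R ^+ T * ((T%:R + k%:R) * m)) by field; rewrite gt_eqF.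
by rewrite ler_pM2l.
Qed.

End LowerBound.

(** * Streaming algorithms as Markov chains, and the number of their states *)

Section Link.
Context {R : realType}.
Set Implicit Arguments.
Unset Strict Implicit.
Variables (X : finType) (N : nat) (A : streaming_alg R X N).

Definition snoc n (p : {ffun 'I_n -> X * bool} * (X * bool)) : {ffun 'I_n.+1 -> X * bool} :=
  [ffun i => if unlift ord_max i is Some j then p.1 j else p.2].

Lemma snoc_max n p : snoc p (@ord_max n) = p.2.
Proof. by rewrite ffunE unlift_none. Qed.

Lemma snoc_widen n p (i : 'I_n) : snoc p (widen_ord (leqnSn n) i) = p.1 i.
Proof.
have -> : widen_ord (leqnSn n) i = lift ord_max i.
  by apply: val_inj; rewrite /= /bump leqNgt ltn_ord.
by rewrite ffunE liftK.
Qed.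

Lemma ex_iid_snoc (P : dist R (X * bool)%type) n f :
  ex (iid P n.+1) f = ex (iid P n) (fun z => ex P (fun x => f (snoc (z, x)))).
Proof.
rewrite /ex; under [RHS]eq_bigr do rewrite mulr_sumr; rewrite pair_big /=.
rewrite (reindex (@snoc n)) /=.
  apply: eq_bigr => -[z x] _; rewrite big_ord_recr snoc_max /= mulrA; congr (_ * _ * _).
  by apply: eq_bigr => i _; rewrite snoc_widen.
exists (fun z => ([ffun i => z (widen_ord (leqnSn n) i)], z ord_max)) => [[z x]|z] _.
  by congr (_, _); rewrite ?snoc_max //; apply/ffunP => i; rewrite ffunE snoc_widen.
apply/ffunP => i; rewrite ffunE /=; case: unliftP => [j ->|-> //].
by rewrite ffunE; congr (z _); apply: val_inj; rewrite /= /bump leqNgt ltn_ord.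
Qed.

Fixpoint marg (P : dist R (X * bool)%type) n : dist R (state A n) :=
  if n is n'.+1 then dbind (marg P n') (fun s => dbind P (step s))
  else dret R (init A).

Lemma exchange_ex (T U : finType) (p : dist R T) (q : dist R U) F :
  ex p (fun x => ex q (F x)) = ex q (fun y => ex p (F^~ y)).
Proof.
rewrite /ex; under eq_bigr do rewrite mulr_sumr.
rewrite exchange_big; apply: eq_bigr => y _ /=; rewrite mulr_sumr.
by apply: eq_bigr => x _; rewrite mulrCA.
Qed.

(** Drawing the whole stream in advance or each example when it is read gives the same law, because
    the last example is independent of the state before it. *)
Lemma ex_iid_run P n f :
  ex (dbind (iid P n) (fun z => run A z)) f = ex (marg P n) f.
Proof.
elim: n f => [|n IH] f.
  rewrite ex_dbind -[RHS](ex_cst (iid P 0)); exact: eq_ex.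
rewrite ex_dbind ex_iid_snoc /= [RHS]ex_dbind -IH ex_dbind; apply: eq_ex => z.
have E x : (fun i => snoc (z, x) (widen_ord (leqnSn n) i)) = z.
  by apply/funext => i; rewrite snoc_widen.
transitivity (ex P (fun x => ex (run A z) (fun s => ex (step s x) f))).
  by apply: eq_ex => x; rewrite ex_dbind E snoc_max.
rewrite exchange_ex; apply: eq_ex => s; by rewrite ex_dbind.
Qed.

(** Encodings have at most [M] bits and need not be prefix-free. Padding them with [None] gives
    words of length exactly [M] over three symbols, and the padding reveals the original length. *)
Lemma card_state t : (1 <= t < N)%N -> (#|state A t| <= 3 ^ memory A)%N.
Proof.
move=> tN; set M := memory A.
have hM (s : state A t) : (size (enc s) <= M)%N.
  apply: (@leq_trans (\max_(s : state A t) size (enc s))).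
    exact: (leq_bigmax (F := fun s : state A t => size (enc s))).
  apply: (leq_bigmax_seq (F := fun t => \max_(s : state A t) size (enc s))) => //.
  by rewrite mem_index_iota.
pose code (s : state A t) : {ffun 'I_M -> option bool} :=
  [ffun i : 'I_M => nth None (map Some (enc s)) i].
have code_inj : injective code.
  move=> s s' /ffunP cs; apply: (@enc_inj _ _ _ A t).
  apply: (inj_map (fun a b => @Some_inj _ a b)).
  have same i : nth None (map Some (enc s)) i = nth None (map Some (enc s')) i.
    case: (ltnP i M) => iM.
      by have := cs (Ordinal iM); rewrite !ffunE.
    by rewrite !nth_default // size_map (leq_trans (hM _)).
  have hsz (l : seq bool) i : (nth None (map Some l) i == None) = (size l <= i)%N.
    by case: ltnP => h; [rewrite (nth_map false) | rewrite nth_default ?size_map].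
  have sz : size (enc s) = size (enc s').
    by apply/eqP; rewrite eqn_leq -!hsz same hsz leqnn -same hsz leqnn.
  by apply: (eq_from_nth (x0 := None)); rewrite ?size_map.
have := leq_card code code_inj.
by rewrite card_ffun card_option card_bool card_ord.
Qed.

End Link.

(** * A single state space for all times *)

Section TaggedStates.
Context {R : realType}.
Set Implicit Arguments.
Unset Strict Implicit.
Variables (k d N : nat) (A : streaming_alg R (ds_input k d) N).
Hypothesis k0 : (0 < k)%N.

(** The chain above lives on one finite type whereas [state A t] varies with [t], hence a disjoint
    union tagged by time. *)
Definition states : finType := {t : 'I_N.+1 & state A t}.

Definition at_time (t : 'I_N.+1) (s : state A t) : states :=
  existT (fun t : 'I_N.+1 => state A t) t s.

Definition tagged_step (g : 'I_k) (w : labelled d) (a : states) : dist R states :=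
  let: existT t s := a in
  if @idP (t < N)%N is ReflectT p then
    dbind (step s (glue g w)) (fun s' => dret R (@at_time (Ordinal (p : t.+1 < N.+1)%N) s'))
  else dret R a.

Definition start : states := @at_time ord0 (init A).

(** Only states tagged [N] carry an output, reached through a transport along the equality of tags;
    the constant [false] is a placeholder at earlier times. *)
Definition readout (a : states) : ds_input k d -> bool :=
  let: existT t s := a in
  if t =P ord_max is ReflectT e then
    @output _ _ _ A (eq_rect t (fun t : 'I_N.+1 => state A t) s ord_max e)
  else fun=> false.

Lemma readout_max s : readout (@at_time ord_max s) = output s.
Proof.
by rewrite /readout /=; case: eqP => // e; rewrite (eq_irrelevance e (erefl _)).
Qed.

Lemma tagged_stepE g w t (s : state A t) (tN : (t < N)%N) (tN1 : (t < N.+1)%N) f :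
  ex (tagged_step g w (@at_time (Ordinal tN1) s)) f =
  ex (step s (glue g w)) (fun s' => f (@at_time (Ordinal (tN : t.+1 < N.+1)%N) s')).
Proof.
rewrite /tagged_step /=; case: {-}_ / idP => [p|]; last by rewrite tN.
rewrite ex_dbind; apply: eq_ex => s'; rewrite ex_dret.
by rewrite (bool_irrelevance p tN).
Qed.

Lemma ex_law_marg v n (nN : (n < N.+1)%N) f :
  ex (law k0 tagged_step start v n) f =
  ex (marg A (population k0 v) n) (fun s => f (@at_time (Ordinal nN) s)).
Proof.
elim: n nN f => [|n IH] nN f.
  rewrite !ex_dret; congr (f _); rewrite /start.
  by rewrite (_ : nN = ltn0Sn N) //; exact: bool_irrelevance.
have nN' : (n < N.+1)%N by exact: ltnW.
rewrite /= !ex_dbind (IH nN'); apply: eq_ex => s.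
rewrite [RHS]ex_dbind ex_population /mix ex_dbind; apply: eq_ex => g.
by rewrite ex_dbind; apply: eq_ex => w; rewrite tagged_stepE.
Qed.

Lemma Pr_law_final v (E : pred (ds_input k d -> bool)) :
  Pr (law k0 tagged_step start v N) (fun a => E (readout a)) =
  Pr (final_state A (population k0 v)) (fun s => E (output s)).
Proof.
rewrite !PrE (ex_law_marg _ (ltnSn N)) /final_state ex_iid_run.
by apply: eq_ex => s; rewrite -readout_max.
Qed.

(** Time is deterministic along a word, so the tags add no entropy and only the states of one time
    count. *)
Lemma tagged_support v w t (s : state A t) (tN : (t < N.+1)%N) (a : states) :
  (t + size w <= N)%N -> runw tagged_step v w (@at_time (Ordinal tN) s) a != 0 ->
  tag a = (t + size w)%N :> nat.
Proof.
elim: w t s tN => [|g w IH] t s tN /=.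
  by rewrite addn0 => _; case: (a =P _) => [-> //|_]; rewrite eqxx.
rewrite addnS => tw; apply: contra_neq_eq => ta.
have tN' : (t < N)%N by apply: leq_trans tw; rewrite ltnS leq_addr.
change (ex (Ker tagged_step v g (@at_time (Ordinal tN) s))
  (fun x => runw tagged_step v w x a) = 0).
rewrite ex_dbind -[RHS](ex0 (sample (v g))); apply: eq_ex => z.
rewrite (tagged_stepE _ _ _ tN') -[RHS](ex0 (step s (glue g z))); apply: eq_ex => s'.
apply/eqP; apply: contraNT ta => /(IH t.+1 s' tN').
by rewrite addSn => /(_ tw) ->.
Qed.

Lemma tagged_entropy v w : (size w < N)%N ->
  entropy (runw tagged_step v w start) <= 2 * (memory A)%:R.
Proof.
(* [memory] does not count the initial state, but that state is deterministic and has entropy 0. *)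
case: w => [_|g w wN]; first by rewrite /= entropy_dret mulr_ge0.
pose B : {set states} := [set a : states | nat_of_ord (tag a) == size (g :: w)]%SET.
have hB a : a \notin B -> runw tagged_step v (g :: w) start a = 0.
  rewrite inE => /eqP ha; apply/eqP; apply/negPn/negP => /tagged_support.
  by rewrite add0n => /(_ (ltnW wN)).
apply: le_trans (entropy_le_card hB) _.
have cB : (#|B| <= 3 ^ memory A)%N.
  have sN : (size (g :: w) < N.+1)%N by exact: ltnW.
  apply: leq_trans (@card_state _ _ _ A (size (g :: w)) _); last by rewrite wN.
  have -> : B = [set @at_time (Ordinal sN) s | s : state A (size (g :: w))]%SET.
    apply/setP => a; rewrite inE; apply/eqP/imsetP => [|[s _ ->] //].
    case: a => -[t tN] s /= e; subst t.
    by exists s => //; rewrite /at_time (bool_irrelevance tN sN).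
  exact: leq_imset_card.
have [B0|Bn0] := posnP #|B|; first by rewrite B0 (le_trans (ln_le0 _)) ?mulr_ge0.
apply: (@le_trans _ _ (ln (3 ^+ memory A))).
  by rewrite ler_ln ?posrE ?ltr0n ?exprn_gt0 // -natrX ler_nat.
rewrite lnXn // -[leLHS]mulr_natr ler_wpM2r //.
have := @ln_le_sub1 R 3; lra.
Qed.

End TaggedStates.


(** * Numerical constants and the asymptotic form *)

Lemma memory_lower_bound (R : realType) (k d N : nat) (A : streaming_alg R (ds_input k d) N) :
  (1 <= k)%N -> (4 <= d)%N -> (1 <= N)%N ->
  agnostically_learns A (@HDS k d) (384^-1) (48^-1) ->
  320^-1 * (k%:R * d%:R) * (k%:R / N%:R) <= (memory A)%:R :> R.
Proof.
case: N A => // T A k0 d4 _ learns.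
pose st := tagged_step (A := A).
have hl (u : coins k d) : 1 - 48^-1 <= Pr (law k0 st (start A) (target u) T.+1)
    (fun s => err (population (R := R) k0 (target u)) (readout s)
     <= inf [set err (population (R := R) k0 (target u)) h | h in @HDS k d] + 384^-1).
  rewrite (Pr_law_final A k0 (target u) (fun h => err (population (R := R) k0 (target u)) h <= _)).
  exact: learns.
have e0 : 0 <= 384^-1 :> R by [].
(* The choice of constants makes [3 * (8 * eps0 + beta0) = 1/8], half of the leading 1/4 in both
   bounds. *)
have h1 := length_bound d4 hl e0.
have h2 := space_bound d4 hl e0 (fun v w sw => tagged_entropy A v (w := w) sw).
set M := (memory A)%:R in h2 *.
have kR : 0 < k%:R :> R by rewrite ltr0n.
have dR : 0 < d%:R :> R by rewrite ltr0n; apply: leq_trans d4.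
have M0 : 0 <= M by rewrite /M.
have kT : k%:R <= 4 * T%:R :> R.
  rewrite -(ler_pM2l dR); lra.
have {}h2 : k%:R * d%:R / 8 <= 8 * M * (T%:R + k%:R) / k%:R.
  by move: h2; rewrite -mulrA; lra.
have h3 : k%:R * d%:R * k%:R <= 64 * M * (T%:R + k%:R).
  by move: h2; rewrite ler_pdivlMr //; lra.
have N0 : 0 < T.+1%:R :> R by [].
rewrite mulrA ler_pdivrMr //.
have -> : T.+1%:R = T%:R + 1 :> R by rewrite natr1.
(* From [k <= 4 * T] follows [T + k <= 5 * T], and [64 * 5 = 320]. *)
have := ler_wpM2l M0 kT; lra.
Qed.

Theorem mainTheorem2 (R : realType) :
  exists eps0 beta0 c C : R,
    [/\ 0 < eps0, 0 < beta0, 0 < c & 0 < C] /\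
    (forall k d' N : nat, (1 <= k)%N -> C <= d'%:R -> (1 <= N)%N ->
      forall A : streaming_alg R (ds_input k d') N,
        agnostically_learns A (@HDS k d') eps0 beta0 ->
        c * (k%:R * d'%:R) * (k%:R / N%:R) <= (memory A)%:R) /\
    (forall k d' N : nat -> nat,
      (forall n, (1 <= k n)%N) -> (forall n, C <= (d' n)%:R) ->
      (forall n, (1 <= N n)%N) ->
      let d : nat -> R^o := fun n => (d' n)%:R + log2 ((k n)%:R : R) in
      (fun n => log2 ((k n)%:R : R) : R^o) =o_\oo d ->
      forall A : forall n, streaming_alg R (ds_input (k n) (d' n)) (N n),
        (forall n, agnostically_learns (A n) (@HDS (k n) (d' n)) eps0 beta0) ->
        (fun n => (memory (A n))%:R : R^o) \is
          'Omega_\oo (fun n => (k n)%:R * d n * ((k n)%:R / (N n)%:R) : R^o)).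
Proof.
exists 384^-1, 48^-1, 320^-1, 4; split; first by split.
split=> [k d N k0 d4 N0 A learns|k d' N k0 d4 N0 d dlog A learns].
  by apply: memory_lower_bound => //; rewrite -(ler_nat R).
rewrite qualifE; apply/asboolP; exists (640^-1) => //.
(* The ratio 1/2 gives [log2 k <= d'], hence [d <= 2 * d'], which turns 320 into 640. *)
have /eqoP/(_ 2^-1) := dlog; rewrite invr_gt0 ltr0n => /(_ isT).
apply: filterS => n; rewrite /d => hn.
have log0 : 0 <= log2 ((k n)%:R : R).
  rewrite /log2 divr_ge0 // ln_ge0 ?ler1n //.
have dn : (4 <= d' n)%N by rewrite -(ler_nat R).
have d0 : 0 <= (d' n)%:R + log2 ((k n)%:R : R) by rewrite addr_ge0.
rewrite (ger0_norm log0) (ger0_norm d0) in hn.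
have b := @memory_lower_bound R _ _ _ (A n) (k0 n) dn (N0 n) (learns n).
rewrite [leRHS]ger0_norm // [X in _ * X]ger0_norm; last by rewrite !mulr_ge0 ?invr_ge0.
apply: le_trans b; set K := (k n)%:R; set F := K / _.
have F0 : 0 <= F by rewrite divr_ge0.
have K0 : 0 <= K by rewrite /K.
have := mulr_ge0 K0 F0 => KF.
have : (d' n)%:R + log2 K <= 2 * (d' n)%:R by rewrite /K; lra.
move=> /(ler_wpM2l KF); lra.
Qed.
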